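(* Let $J\in\mathbb{C}^{q\times q}$ be a signature matrix and let $F\in\mathbb{C}^{q\times q}\langle\langle z_1,\ldots,z_N\rangle\rangle_{\rm rat}$ be a rational formal power series which is matrix-$J$-unitary on $\mathcal{J}_N$. Let $\mathcal{K}(F)=\bigoplus_{k=1}^N\mathcal{K}_k(F)$ be the de Branges--Rovnyak space of $F$, and define the operators $A_{kj}:\mathcal{K}_j(F)\to\mathcal{K}_k(F)$, $A:\mathcal{K}(F)\to\mathcal{K}(F)$, $B:\mathbb{C}^q\to\mathcal{K}(F)$, $C:\mathcal{K}(F)\to\mathbb{C}^q$, $D:\mathbb{C}^q\to\mathbb{C}^q$ by $$A_{kj}=R_k\big|_{\mathcal{K}_j(F)}\ (k,j=1,\ldots,N),\qquad A=(A_{kj})_{k,j=1,\ldots,N},$$ $$B:\ c\mapsto\begin{pmatrix}R_1F(z)c\\ \vdots\\ R_NF(z)c\end{pmatrix},\qquad C:\ \begin{pmatrix}f_1(z)\\ \vdots\\ f_N(z)\end{pmatrix}\mapsto\sum_{k=1}^N(f_k)_\emptyset,\qquad D=F_\emptyset,$$ where $R_1,\ldots,R_N$ are the backward shift operators. Then the GR-node $\alpha=(N;A,B,C,D;\mathcal{K}(F)=\bigoplus_{k=1}^N\mathcal{K}_k(F),\mathbb{C}^q)$ is a minimal GR-realization of $F$.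
   Context: Formal power series. $\mathcal{F}_N$ is the free monoid on generators $g_1,\ldots,g_N$ with empty word $\emptyset$. A formal power series (FPS) in non-commuting indeterminates $z_1,\ldots,z_N$ is $f(z)=\sum_{w\in\mathcal{F}_N}f_wz^w$, where $z^w=z_{i_1}\cdots z_{i_n}$ for $w=g_{i_1}\cdots g_{i_n}$; the indeterminates commute with coefficients and products are by convolution over factorizations of words. A scalar FPS is rational if it is obtained from non-commutative polynomials by finitely many sums, products and inversions (of FPSs with non-zero constant term); a matrix (or vector) FPS is rational if all its entries are. GR-nodes. A GR-node $\alpha=(N;A,B,C,D;\mathcal{X}=\bigoplus_{k=1}^N\mathcal{X}_k,\mathbb{C}^q)$, with finite-dimensional linear spaces $\mathcal{X}_k$, consists of linear operators $A:\mathcal{X}\to\mathcal{X}$, $B:\mathbb{C}^q\to\mathcal{X}$, $C:\mathcal{X}\to\mathbb{C}^q$, $D:\mathbb{C}^q\to\mathbb{C}^q$, with blocks $A_{ij},B_i,C_j$. Its transfer function is the FPS $T^{\rm nc}_\alpha(z)=D+C(I-\Delta(z)A)^{-1}\Delta(z)B$, $\Delta(z)={\rm diag}(z_1I_{\mathcal{X}_1},\ldots,z_NI_{\mathcal{X}_N})$, i.e. the coefficient at $\emptyset$ is $D$ and at $w=g_{j_1}\cdots g_{j_n}$ it is $C_{j_1}A_{j_1j_2}\cdots A_{j_{n-1}j_n}B_{j_n}$. $\alpha$ is a GR-realization of $F$ if $T_\alpha^{\rm nc}=F$; it is minimal if each $\dim\mathcal{X}_k$ is the smallest possible among all GR-realizations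 of $F$. The minimal dimensions are denoted by $\gamma_k$, $\gamma=\sum_k\gamma_k$. Evaluation and matrix-$J$-unitarity. For $Z\in(\mathbb{C}^{n\times n})^N$, $F(Z)$ is obtained by substituting $Z_k$ for $z_k$ in a rational expression for $F$; near $0$ it equals $\sum_wF_w\otimes Z^w$, and it is a rational function of the entries of the $Z_k$, defined on an open dense set. A signature matrix is $J$ with $J=J^*=J^{-1}$. With $\mathbb{H}^{n\times n}$ the Hermitian $n\times n$ matrices and $\mathcal{J}_N=\coprod_n(i\mathbb{H}^{n\times n})^N$, $F$ is matrix-$J$-unitary on $\mathcal{J}_N$ if for every $n$, $F(Z)(J\otimes I_n)F(Z)^*=J\otimes I_n$ at all $Z\in(i\mathbb{H}^{n\times n})^N$ where $F(Z)$ is defined. For such $F$ and any minimal GR-realization $(N;\mathring A,\mathring B,\mathring C,\mathring D;\mathbb{C}^\gamma=\bigoplus\mathbb{C}^{\gamma_k},\mathbb{C}^q)$ of $F$ there is a unique invertible Hermitian $\mathring H={\rm diag}(\mathring H_1,\ldots,\mathring H_N)$, $\mathring H_k\in\mathbb{C}^{\gamma_k\times\gamma_k}$, with $\mathring A^*\mathring H+\mathring H\mathring A=-\mathring C^*J\mathring C$ and $\mathring B=-\mathring H^{-1}\mathring C^*J\mathring D$. The spaces $\mathcal{K}_k(F)$. For $w=g_{j_1}\cdots g_{j_m}$ put $(\mathring C\flat\mathring A)^{wg_k}=\mathring C_{j_1}\mathring A_{j_1j_2}\cdots\mathring A_{j_{m-1}j_m}\mathring A_{j_mk}$, and $(\mathring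 C\flat\mathring A)^{g_k}=\mathring C_k$. Set $K^{F,k}_{w,w'}=(\mathring C\flat\mathring A)^{wg_k}\,\mathring H_k^{-1}\,\big((\mathring C\flat\mathring A)^{w'g_k}\big)^*\in\mathbb{C}^{q\times q}$ for $w,w'\in\mathcal{F}_N$ (this does not depend on the choice of the minimal GR-realization). $\mathcal{K}_k(F)$ is the linear span of the FPSs $K^{F,k}_{w'}(z)c=\sum_{w\in\mathcal{F}_N}K^{F,k}_{w,w'}c\,z^w$, $w'\in\mathcal{F}_N$, $c\in\mathbb{C}^q$ (equipped in the paper with the indefinite inner product with reproducing kernel $K^{F,k}$), and $\mathcal{K}(F)=\bigoplus_{k=1}^N\mathcal{K}_k(F)$. Backward shifts. For $k=1,\ldots,N$, $R_k$ acts on rational FPSs with coefficients in $\mathbb{C}^q$ by $R_k:\sum_wf_wz^w\mapsto\sum_wf_{wg_k}z^w$. One has $R_kF(z)c\in\mathcal{K}_k(F)$ for all $c\in\mathbb{C}^q$ and $R_k\mathcal{K}_j(F)\subset\mathcal{K}_k(F)$ for all $j,k$, so that the operators in the claim are well defined. *)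

(* Defs.v *)
From HB Require Import structures.
From mathcomp Require Import all_boot all_order all_algebra.
From mathcomp.real_closed Require Import complex mxtens.
From mathcomp Require Import boolp classical_sets functions reals.

Set Implicit Arguments.
Unset Strict Implicit.
Unset Printing Implicit Defensive.
Import Order.TTheory GRing.Theory Num.Theory.
Local Open Scope ring_scope.

Notation ctr A := (map_mx Num.conj A^T).

Definition hermitian (K : numClosedFieldType) n (X : 'M[K]_n) : Prop :=
  ctr X = X.

(* [invmx J = J] would be junk for a singular J, hence [J *m J = 1%:M]. *)
Definition signature_mx (K : numClosedFieldType) q (J : 'M[K]_q) : Prop :=
  hermitian J /\ J *m J = 1%:M.

(* The word g_{i_1} ... g_{i_n} is the sequence [:: i_1; ...; i_n]. *)
Notation word N := (seq 'I_N).

Notation fps N V := (word N -> V).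

Section RationalSeries.
Variables (K : numClosedFieldType) (N : nat).

Definition fps_const (c : K) : fps N K := fun w => if w is [::] then c else 0.

Definition fps_var (k : 'I_N) : fps N K := fun w => (w == [:: k])%:R.

Definition fps_mul (f g : fps N K) : fps N K :=
  fun w => \sum_(i < (size w).+1) f (take i w) * g (drop i w).

Inductive rexp :=
| RConst of K
| RVar of 'I_N
| RAdd of rexp & rexp
| RMul of rexp & rexp
| RInv of rexp.

(* [expands e f]: every inverted subexpression of [e] expands to a series with
   non-zero constant term, and [e] expands to [f]. *)
Fixpoint expands (e : rexp) (f : fps N K) : Prop :=
  match e with
  | RConst c => f = fps_const c
  | RVar k => f = fps_var k
  | RAdd e1 e2 => exists f1 f2,
      [/\ expands e1 f1, expands e2 f2 & f = (fun w => f1 w + f2 w)]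
  | RMul e1 e2 => exists f1 f2,
      [/\ expands e1 f1, expands e2 f2 & f = fps_mul f1 f2]
  | RInv e1 => exists f1,
      [/\ expands e1 f1, f1 [::] != 0,
          fps_mul f f1 = fps_const 1 & fps_mul f1 f = fps_const 1]
  end.

Definition rational_fps (f : fps N K) : Prop := exists e, expands e f.

Definition rational_mxfps p q (F : fps N 'M[K]_(p, q)) : Prop :=
  forall i j, rational_fps (fun w => F w i j).

(* [eval_rexp Z e M]: [e] is defined at the matrices [Z], with value [M]. *)
Fixpoint eval_rexp n (Z : 'I_N -> 'M[K]_n) (e : rexp) (M : 'M[K]_n) : Prop :=
  match e with
  | RConst c => M = c%:M
  | RVar k => M = Z k
  | RAdd e1 e2 => exists M1 M2,
      [/\ eval_rexp Z e1 M1, eval_rexp Z e2 M2 & M = M1 + M2]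
  | RMul e1 e2 => exists M1 M2,
      [/\ eval_rexp Z e1 M1, eval_rexp Z e2 M2 & M = M1 *m M2]
  | RInv e1 => exists M1,
      [/\ eval_rexp Z e1 M1, M1 \in unitmx & M = invmx M1]
  end.

(* [eval_mxfps F Z M]: [F(Z)] is defined, with value [M]; the blocks of [M]
   are the values of the entries of [F], as in sum_w F_w (x) Z^w. *)
Definition eval_mxfps q (F : fps N 'M[K]_q) n (Z : 'I_N -> 'M[K]_n)
    (M : 'M[K]_(q * n)) : Prop :=
  exists (e : 'I_q -> 'I_q -> rexp) (V : 'I_q -> 'I_q -> 'M[K]_n),
    [/\ forall i j, expands (e i j) (fun w => F w i j),
        forall i j, eval_rexp Z (e i j) (V i j)
      & M = \sum_i \sum_j (delta_mx i j : 'M[K]_q) *t V i j].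

Definition matrix_J_unitary q (J : 'M[K]_q) (F : fps N 'M[K]_q) : Prop :=
  forall n (Z : 'I_N -> 'M[K]_n) (M : 'M[K]_(q * n)),
    (forall k, exists2 X : 'M[K]_n, hermitian X & Z k = 'i *: X) ->
    eval_mxfps F Z M ->
    M *m (J *t 1%:M) *m ctr M = J *t 1%:M.

End RationalSeries.

(* An operator on the direct sum of the state spaces is given by its blocks. *)
Record GRnode (K : fieldType) (N q : nat) := GRNode {
  state : 'I_N -> vectType K;
  nodeA : forall i j, {linear state j -> state i};
  nodeB : forall i, {linear 'cV[K]_q -> state i};
  nodeC : forall j, {linear state j -> 'cV[K]_q};
  nodeD : {linear 'cV[K]_q -> 'cV[K]_q}
}.

Section Transfer.
Variables (K : fieldType) (N q : nat).
Implicit Types (a : GRnode K N q) (F : fps N 'M[K]_q).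

(* A_{k j_2} ... A_{j_{n-1} j_n} B_{j_n} for the word k :: [:: j_2; ...; j_n] *)
Fixpoint node_AB a (k : 'I_N) (w : word N) (c : 'cV[K]_q) : state a k :=
  if w is j :: w' then nodeA a k j (node_AB a j w' c) else nodeB a k c.

Definition transfer a (w : word N) (c : 'cV[K]_q) : 'cV[K]_q :=
  if w is j :: w' then nodeC a j (node_AB a j w' c) else nodeD a c.

Definition GR_realization a F : Prop := forall w c, transfer a w c = F w *m c.

Definition minimal_GR_realization a F : Prop :=
  GR_realization a F /\
  forall b, GR_realization b F ->
    forall k, (\dim {:state a k} <= \dim {:state b k})%N.

End Transfer.

Record mxnode (K : fieldType) (N q : nat) := MxNode {
  mxdim : 'I_N -> nat;
  mxA : forall i j, 'M[K]_(mxdim i, mxdim j);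
  mxB : forall i, 'M[K]_(mxdim i, q);
  mxC : forall j, 'M[K]_(q, mxdim j);
  mxD : 'M[K]_q
}.

Definition node_of_mx (K : fieldType) N q (m : mxnode K N q) : GRnode K N q :=
  @GRNode K N q (fun k => 'cV[K]_(mxdim m k))
    (fun i j => mulmx (mxA m i j)) (fun i => mulmx (mxB m i))
    (fun j => mulmx (mxC m j)) (mulmx (mxD m)).

Section Kernel.
Variables (K : numClosedFieldType) (N q : nat).
Implicit Types (m : mxnode K N q) (F : fps N 'M[K]_q) (J : 'M[K]_q).

(* A_{j j_1} A_{j_1 j_2} ... A_{j_n k} for the word [:: j_1; ...; j_n] *)
Fixpoint mxAA m (j : 'I_N) (w : word N) (k : 'I_N) :
    'M[K]_(mxdim m j, mxdim m k) :=
  if w is i :: w' then mxA m j i *m mxAA m i w' k else mxA m j k.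

(* (C flat A)^{w g_k} *)
Definition mxCA m (w : word N) (k : 'I_N) : 'M[K]_(q, mxdim m k) :=
  if w is j :: w' then mxC m j *m mxAA m j w' k else mxC m k.

(* H = diag(H_1, ..., H_N) is Hermitian and invertible, A^* H + H A = - C^* J C
   and B = - H^{-1} C^* J D, written blockwise. *)
Definition associated_hermitian J m (H : forall k, 'M[K]_(mxdim m k)) : Prop :=
  [/\ forall k, hermitian (H k) /\ H k \in unitmx,
      forall i j, ctr (mxA m j i) *m H j + H i *m mxA m i j
                  = - (ctr (mxC m i) *m J *m mxC m j)
    & forall k, mxB m k = - (invmx (H k) *m ctr (mxC m k) *m J *m mxD m)].

Definition mxkernel m (H : forall k, 'M[K]_(mxdim m k)) :
    'I_N -> word N -> word N -> 'M[K]_q :=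
  fun k w w' => mxCA m w k *m invmx (H k) *m ctr (mxCA m w' k).

(* The kernels K^{F,k}: all minimal GR-realizations of a matrix-J-unitary F
   yield the same value, so the choice made by [xget] is immaterial; its default
   value 0 is only taken when there is no minimal GR-realization of F with an
   associated Hermitian matrix. *)
Definition dBR_kernel J F : 'I_N -> word N -> word N -> 'M[K]_q :=
  xget (fun _ _ _ => 0)
    [set Ker | exists m (H : forall k, 'M[K]_(mxdim m k)),
       [/\ minimal_GR_realization (node_of_mx m) F,
           associated_hermitian J H
         & Ker = mxkernel H]]%classic.

End Kernel.

Section LinearSpan.
Variables (K : fieldType) (V : lmodType K) (S : set V).

Definition in_span (v : V) : Prop :=
  exists n (a : 'I_n -> K) (u : 'I_n -> V),
    (forall i, S (u i)) /\ v = \sum_i a i *: u i.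

Definition span_pred : {pred V} := fun v => `[< in_span v >].

Fact span_pred_submod_closed : submod_closed span_pred.
Proof.
split=> [|a u v /asboolP[n [b [x [Sx ->]]]] /asboolP[m [c [y [Sy ->]]]]].
  by apply/asboolP; exists 0%N, (fun=> 0), (fun=> 0); split=> [[]|] //; rewrite big_ord0.
apply/asboolP; exists (n + m)%N.
exists (fun i => match fintype.split i with inl j => a * b j | inr j => c j end).
exists (fun i => match fintype.split i with inl j => x j | inr j => y j end).
split=> [i|]; first by case: fintype.split.
rewrite big_split_ord scaler_sumr /=; congr (_ + _); apply: eq_bigr => i _.
  by rewrite (unsplitK (inl i)) scalerA.
by rewrite (unsplitK (inr i)).
Qed.

HB.instance Definition _ :=
  GRing.isSubmodClosed.Build K V span_pred span_pred_submod_closed.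

Record lspan := Lspan { lspan_val :> V; _ : lspan_val \in span_pred }.

HB.instance Definition _ := [isSub for lspan_val].
HB.instance Definition _ := [Choice of lspan by <:].
HB.instance Definition _ := [SubChoice_isSubZmodule of lspan by <:].
HB.instance Definition _ := [SubZmodule_isSubLmodule of lspan by <:].

End LinearSpan.

(* A finite-dimensional linear space as a [vectType]; the carrier and the linear
   structure are those of [V]. *)
Definition findim (K : fieldType) (V : lmodType K) d
    (coords : Vector.axiom d V) : vectType K :=
  HB.pack V (Lmodule_hasFinDim.Build K V coords).

(* The space K_k(F), a subspace of the space of series with coefficients in the
   column vectors. *)
Definition dBR (K : numClosedFieldType) N q (J : 'M[K]_q)
    (F : fps N 'M[K]_q) (k : 'I_N) : lmodType K :=
  lspan [set f : fps N 'cV[K]_q | exists w' c,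
           f = fun w => dBR_kernel J F k w w' *m c]%classic.

Definition dBR_fps (K : numClosedFieldType) N q (J : 'M[K]_q)
    (F : fps N 'M[K]_q) (k : 'I_N) (f : dBR J F k) : fps N 'cV[K]_q :=
  lspan_val f.

Definition bshift N (V : Type) (k : 'I_N) (f : fps N V) : fps N V :=
  fun w => f (rcons w k).

(* Main.v *)
Require Import Defs.
From HB Require Import structures.
From mathcomp Require Import all_boot all_order all_algebra.
From mathcomp.real_closed Require Import complex mxtens.
From mathcomp Require Import boolp classical_sets functions reals.

Set Implicit Arguments.
Unset Strict Implicit.
Unset Printing Implicit Defensive.
Import Order.TTheory GRing.Theory Num.Theory.
Local Open Scope ring_scope.

(* Let (A, B, C, D) be a minimal realization of F with associated Hermitian matrix
   H, computing the kernels K^{F,k}.  Observability makes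
   x |-> (w |-> (C flat A)^{w g_k} x) an isomorphism of the k-th state space onto
   K_k(F), and this isomorphism carries (A, B, C, D) to the backward-shift node.

   Existence of H.  J-unitarity first gives an identity of series,
   F(z) J F^#(z) = J with F^#_w = (-1)^|w| (F_{w reversed})^*: a rational
   expression vanishing at all skew-Hermitian tuples where it is defined expands
   to 0, because tridiagonal skew-Hermitian matrices carrying the letters of a
   word w on their off-diagonals are similar to perturbations of a nilpotent tuple
   at which the expression has corner entry f_w.  Hence F^{-1} = J F^# J has two
   reachable and observable realizations, the inverse node built from
   A - B D^{-1} C and the adjoint node built from -A^*; the matrix intertwining
   them is -H. *)

(** * Convolution of matrix series, finite spans *)

Section Convolution.
Variables (K : pzRingType) (N : nat).

Definition conv p q r (f : fps N 'M[K]_(p, q)) (g : fps N 'M[K]_(q, r)) :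
    fps N 'M[K]_(p, r) :=
  fun w => \sum_(i < (size w).+1) f (take i w) *m g (drop i w).

Lemma conv_nil p q r (f : fps N 'M[K]_(p, q)) (g : fps N 'M[K]_(q, r)) :
  conv f g [::] = f [::] *m g [::].
Proof. by rewrite /conv big_ord_recl big_ord0 addr0. Qed.

Lemma conv_cons p q r (f : fps N 'M[K]_(p, q)) (g : fps N 'M[K]_(q, r)) j w :
  conv f g (j :: w) =
  f [::] *m g (j :: w) + conv (fun u => f (j :: u)) g w.
Proof. by rewrite /conv big_ord_recl. Qed.

Lemma eq_conv p q r (f f' : fps N 'M[K]_(p, q)) (g g' : fps N 'M[K]_(q, r)) :
  f =1 f' -> g =1 g' -> conv f g =1 conv f' g'.
Proof. by move=> ef eg w; apply: eq_bigr => i _; rewrite ef eg. Qed.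

Lemma conv_mull p q r s (L : 'M[K]_(s, p)) (f : fps N 'M[K]_(p, q))
    (g : fps N 'M[K]_(q, r)) w :
  conv (fun u => L *m f u) g w = L *m conv f g w.
Proof. by rewrite /conv mulmx_sumr; apply: eq_bigr => i _; rewrite mulmxA. Qed.

Lemma conv_mulr p q r s (L : 'M[K]_(r, s)) (f : fps N 'M[K]_(p, q))
    (g : fps N 'M[K]_(q, r)) w :
  conv f (fun u => g u *m L) w = conv f g w *m L.
Proof. by rewrite /conv mulmx_suml; apply: eq_bigr => i _; rewrite mulmxA. Qed.

Lemma conv_addl p q r (f f' : fps N 'M[K]_(p, q)) (g : fps N 'M[K]_(q, r)) w :
  conv (fun u => f u + f' u) g w = conv f g w + conv f' g w.
Proof. by rewrite /conv -big_split; apply: eq_bigr => i _; rewrite mulmxDl. Qed.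

Lemma convA p q r s (f : fps N 'M[K]_(p, q)) (g : fps N 'M[K]_(q, r))
    (h : fps N 'M[K]_(r, s)) w :
  conv f (conv g h) w = conv (conv f g) h w.
Proof.
elim: w f => [|j w IHw] f; first by rewrite !conv_nil mulmxA.
rewrite !conv_cons IHw conv_nil mulmxDr !mulmxA -addrA; congr (_ + _).
rewrite -conv_mull -conv_addl; apply: eq_conv => // u.
by rewrite conv_cons.
Qed.

Definition conv1 q : fps N 'M[K]_q := fun w => if w is [::] then 1%:M else 0.

Lemma conv1l p q (f : fps N 'M[K]_(p, q)) w : conv (@conv1 p) f w = f w.
Proof.
case: w => [|j w]; first by rewrite conv_nil mul1mx.
rewrite conv_cons mul1mx [X in _ + X]big1 ?addr0 // => i _.
by rewrite mul0mx.
Qed.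

Lemma conv1r p q (f : fps N 'M[K]_(p, q)) w : conv f (@conv1 q) w = f w.
Proof.
elim: w f => [|j w IHw] f; first by rewrite conv_nil mulmx1.
by rewrite conv_cons IHw mulmx0 add0r.
Qed.

Lemma conv_inv_uniq q (f g h : fps N 'M[K]_q) :
  conv g f =1 @conv1 q -> conv f h =1 @conv1 q -> g =1 h.
Proof.
move=> gf fh w; rewrite -(conv1r g) -(conv1l h).
by rewrite -(eq_conv (fun=> erefl) fh) convA; apply: eq_conv.
Qed.

End Convolution.

Section FiniteSpan.
Variable K : fieldType.

(** Independent subfamilies have at most [n] members, so one of maximal size exists; a row outside
    its span could be adjoined to it. *)
Lemma span_finite (I : Type) n (v : I -> 'rV[K]_n) :
  exists r (s : 'I_r -> I), row_free (\matrix_i v (s i)) /\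
    forall i, (v i <= \matrix_j v (s j))%MS.
Proof.
pose P r := `[< exists s : 'I_r -> I, row_free (\matrix_i v (s i)) >].
have P0 : exists r, P r.
  exists 0%N; apply/asboolP; exists (fun i : 'I_0 => False_rect I (notF (ltn_ord i))).
  by rewrite /row_free -leqn0 rank_leq_row.
have Pn r : P r -> (r <= n)%N.
  by move=> /asboolP[s /eqP fs]; rewrite -{1}fs rank_leq_col.
case: (ex_maxnP P0 Pn) => r /asboolP[s fs] maxr.
exists r, s; split=> // i.
apply: contraT => nvi.
have/maxr : P r.+1; last by rewrite ltnn.
apply/asboolP.
pose t (j : 'I_(1 + r)) := match fintype.split j with inl _ => i | inr k => s k end.
exists t.
have -> : \matrix_j v (t j) = col_mx (v i) (\matrix_j v (s j)) :> 'M_(1 + r, n).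
  apply/row_matrixP => j; rewrite rowK /t.
  case: (@split_ordP 1 r j) => k ->.
    by rewrite rowKu [k]ord1 row_id.
  by rewrite rowKd rowK.
suff : (1 + r <= \rank (col_mx (v i) (\matrix_j v (s j))))%N by rewrite row_leq_rank.
rewrite -addsmxE mxrank_disjoint_sum.
  rewrite (eqP fs) leq_add2r lt0n mxrank_eq0.
  by apply: contraNneq nvi => ->; rewrite sub0mx.
apply/eqP; rewrite -submx0.
(* The rank of [v i] is at most 1, so a non-zero intersection is the whole line of [v i], against
   [nvi]. *)
have [|] := leqP (\rank (v i :&: \matrix_j v (s j))%MS) 0.
  by rewrite leqn0 mxrank_eq0 => /eqP ->.
move=> rk; case/negP: nvi.
have := mxrank_leqif_eq (capmxSl (v i) (\matrix_j v (s j))).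
move=> [_ h]; have : (v i <= v i :&: \matrix_j v (s j))%MS.
  have : \rank (v i :&: \matrix_j v (s j))%MS == \rank (v i).
    by rewrite eqn_leq mxrankS ?capmxSl // (leq_trans (rank_leq_row _)).
  by rewrite h => /andP[].
by rewrite sub_capmx => /andP[].
Qed.

(** A column killed by the rows from [span_finite] is killed by every [v i], hence is 0; so there
    are exactly [n] rows. *)
Lemma basis_extract (I : Type) n (v : I -> 'rV[K]_n) :
  (forall x : 'cV_n, (forall i, v i *m x = 0) -> x = 0) ->
  exists s : 'I_n -> I, \matrix_i v (s i) \in unitmx.
Proof.
move=> ann; have [r [s [fs vs]]] := span_finite v.
have rn : r = n.
  apply/eqP; rewrite -{1}(eqP fs) eqn_leq rank_leq_col /=.
  have : row_free (\matrix_j v (s j))^T.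
    rewrite -kermx_eq0; apply/eqP/row_matrixP => i; rewrite row0.
    apply: (can_inj trmxK); rewrite trmx0; apply: ann => k.
    have /submxP[D ->] := vs k.
    rewrite -mulmxA -[X in D *m X]trmxK trmx_mul trmxK -row_mul mulmx_ker.
    by rewrite row0 trmx0 mulmx0.
  by move=> /eqP; rewrite mxrank_tr => ->.
by move: s fs {vs}; rewrite rn => s fs; exists s; rewrite -row_free_unit.
Qed.

End FiniteSpan.

(** * Rational series are recognizable *)

Section Recognizable.
Variables (K : numClosedFieldType) (N : nat).

(** A linear representation F_w = c M_{j_1} ... M_{j_n} G_∅. The whole state series [G] is kept, so
    that a closure proof only has to name the new state and check its recursion. *)
Definition recognizable p q (F : fps N 'M[K]_(p, q)) : Prop :=
  exists n (M : 'I_N -> 'M[K]_n) (c : 'M[K]_(p, n)) (G : fps N 'M[K]_(n, q)),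
    (forall j w, G (j :: w) = M j *m G w) /\ forall w, F w = c *m G w.

Lemma recognizable_ext p q (F G : fps N 'M[K]_(p, q)) :
  F =1 G -> recognizable F -> recognizable G.
Proof.
move=> FG [n [M [c [H [HM Hc]]]]]; exists n, M, c, H.
by split=> // w; rewrite -FG Hc.
Qed.

Lemma recognizable0 p q : recognizable (fun _ : word N => 0 : 'M[K]_(p, q)).
Proof.
exists 0%N, (fun=> 0), 0, (fun=> 0); split=> [j w|w]; first by rewrite mul0mx.
by rewrite mul0mx.
Qed.

Lemma recognizable_const p q (A : 'M[K]_(p, q)) :
  recognizable (fun w : word N => if w is [::] then A else 0).
Proof.
exists p, (fun=> 0), 1%:M, (fun w => if w is [::] then A else 0).
by split=> [j w|w]; rewrite ?mul0mx ?mul1mx.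
Qed.

Lemma recognizable_var (k : 'I_N) :
  recognizable (fun w => (@fps_var K N k w)%:M : 'M[K]_1).
Proof.
(* The state consists of the coefficient of z_k and the indicator of the empty word. *)
exists (1 + 1)%N, (fun j => block_mx 0 (j == k)%:R%:M 0 0), (row_mx 1%:M 0).
exists (fun w => col_mx (fps_var K k w)%:M (if w is [::] then 1%:M else 0)).
split=> [j w|w]; last by rewrite mul_row_col mul1mx mul0mx addr0.
rewrite mul_block_col !mul0mx !add0r; congr (col_mx _ _).
case: w => [|i w]; rewrite /fps_var ?mulmx0 ?mulmx1 eqseq_cons ?andbT //.
by rewrite andbF raddf0.
Qed.

Lemma recognizableD p q (F G : fps N 'M[K]_(p, q)) :
  recognizable F -> recognizable G -> recognizable (fun w => F w + G w).
Proof.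
move=> [n1 [M1 [c1 [G1 [GM1 Gc1]]]]] [n2 [M2 [c2 [G2 [GM2 Gc2]]]]].
exists (n1 + n2)%N, (fun j => block_mx (M1 j) 0 0 (M2 j)), (row_mx c1 c2).
exists (fun w => col_mx (G1 w) (G2 w)); split=> [j w|w].
  by rewrite mul_block_col !mul0mx addr0 add0r GM1 GM2.
by rewrite mul_row_col Gc1 Gc2.
Qed.

Lemma recognizable_sum (I : Type) (s : seq I) p q (F : I -> fps N 'M[K]_(p, q)) :
  (forall i, recognizable (F i)) ->
  recognizable (fun w => \sum_(i <- s) F i w).
Proof.
move=> recF; elim: s => [|i s IHs].
  by apply: recognizable_ext (recognizable0 p q) => w; rewrite big_nil.
by apply: recognizable_ext (recognizableD (recF i) IHs) => w; rewrite big_cons.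
Qed.

Lemma recognizable_conv p q r (F : fps N 'M[K]_(p, q)) (G : fps N 'M[K]_(q, r)) :
  recognizable F -> recognizable G -> recognizable (conv F G).
Proof.
move=> [n1 [M1 [c1 [G1 [GM1 Gc1]]]]] [n2 [M2 [c2 [G2 [GM2 Gc2]]]]].
(* The upper right block produces the term of the convolution whose left factor is read at the empty
   word. *)
exists (n1 + n2)%N, (fun j => block_mx (M1 j) (G1 [::] *m c2 *m M2 j) 0 (M2 j)).
exists (row_mx c1 0), (fun w => col_mx (conv G1 G w) (G2 w)); split=> [j w|w].
  rewrite mul_block_col mul0mx add0r GM2; congr (col_mx _ _).
  rewrite conv_cons addrC; congr (_ + _); last by rewrite Gc2 GM2 !mulmxA.
  by rewrite -conv_mull; apply: eq_conv.
rewrite mul_row_col mul0mx addr0 -conv_mull.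
exact: eq_conv.
Qed.

Lemma recognizable_inv q (F G : fps N 'M[K]_q) :
  conv F G =1 @conv1 K N q -> conv G F =1 @conv1 K N q -> recognizable F ->
  recognizable G.
Proof.
move=> FG GF [n [M [c [H [HM Hc]]]]].
(* Multiply the series u -> G_{ju} by F G = 1; by G F = 1, its product with F is u -> - G_∅ F_{ju}.
   Hence [G] and [conv H G] together form a state. *)
have Gj j w : G (j :: w) = - (G [::] *m c *m M j) *m conv H G w.
  transitivity (conv (conv (fun u => G (j :: u)) F) G w).
    by rewrite -convA (eq_conv (fun=> erefl) FG) conv1r.
  rewrite -conv_mull; apply: eq_conv => // u.
  have /eqP := GF (j :: u); rewrite conv_cons /= addrC addr_eq0 => /eqP ->.
  by rewrite Hc HM mulNmx !mulmxA.
exists (q + n)%N.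
exists (fun j => block_mx 0 (- (G [::] *m c *m M j)) 0
                   (M j - H [::] *m G [::] *m c *m M j)).
exists (row_mx 1%:M 0), (fun w => col_mx (G w) (conv H G w)).
split=> [j w|w]; last by rewrite mul_row_col mul1mx mul0mx addr0.
rewrite mul_block_col !mul0mx !add0r -Gj; congr (col_mx _ _).
rewrite conv_cons Gj mulmxBl addrC mulNmx mulmxN !mulmxA; congr (_ - _).
by rewrite -conv_mull; apply: eq_conv.
Qed.

Lemma fps_mul_conv (f g : fps N K) w :
  (fps_mul f g w)%:M = conv (fun u => (f u)%:M : 'M_1) (fun u => (g u)%:M) w.
Proof.
rewrite /fps_mul raddf_sum; apply: eq_bigr => i _.
by rewrite -scalar_mxM.
Qed.

Lemma fps_const_conv1 w : (@fps_const K N 1 w)%:M = @conv1 K N 1 w.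
Proof. by case: w => [|j w] //=; rewrite raddf0. Qed.

Lemma rational_recognizable (f : fps N K) :
  rational_fps f -> recognizable (fun w => (f w)%:M : 'M[K]_1).
Proof.
case=> e; elim: e f => [c|k|e1 IH1 e2 IH2|e1 IH1 e2 IH2|e1 IH1] f /=.
- move->; apply: recognizable_ext (recognizable_const c%:M) => -[|j w] //=.
  by rewrite raddf0.
- by move->; apply: recognizable_var.
- move=> [f1 [f2 [/IH1 r1 /IH2 r2 ->]]].
  by apply: recognizable_ext (recognizableD r1 r2) => w; rewrite raddfD.
- move=> [f1 [f2 [/IH1 r1 /IH2 r2 ->]]].
  apply: recognizable_ext (recognizable_conv r1 r2) => w.
  by rewrite fps_mul_conv.
move=> [f1 [/IH1 r1 _ ff1 f1f]]; apply: recognizable_inv r1 => w.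
  by rewrite -fps_mul_conv f1f fps_const_conv1.
by rewrite -fps_mul_conv ff1 fps_const_conv1.
Qed.

Lemma recognizable_mul p q r s (L : 'M[K]_(p, q)) (F : fps N 'M[K]_(q, r))
    (E : 'M[K]_(r, s)) :
  recognizable F -> recognizable (fun w => L *m F w *m E).
Proof.
move=> [n [M [c [G [GM Gc]]]]].
exists n, M, (L *m c), (fun w => G w *m E); split=> [j w|w].
  by rewrite GM mulmxA.
by rewrite Gc !mulmxA.
Qed.

Lemma rational_mx_recognizable p q (F : fps N 'M[K]_(p, q)) :
  rational_mxfps F -> recognizable F.
Proof.
move=> ratF.
have recF : recognizable (fun w => \sum_i \sum_j
    (delta_mx i ord0 : 'M_(p, 1)) *m (F w i j)%:M *m (delta_mx ord0 j : 'M_(1, q))).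
  apply: recognizable_sum => i; apply: recognizable_sum => j.
  exact/recognizable_mul/rational_recognizable.
apply: recognizable_ext recF => w; rewrite [RHS]matrix_sum_delta.
apply: eq_bigr => i _; apply: eq_bigr => j _.
by rewrite mul_mx_scalar -scalemxAl mul_delta_mx.
Qed.

End Recognizable.

(** * Reachability, observability and the adjoint node *)

Lemma col_mul (K : pzRingType) m n p (i : 'I_p) (A : 'M[K]_(m, n)) (B : 'M_(n, p)) :
  col i (A *m B) = A *m col i B.
Proof. by rewrite !colE mulmxA. Qed.

Section MatrixNodes.
Variables (K : numClosedFieldType) (N q : nat).
Implicit Types (m : mxnode K N q) (F : fps N 'M[K]_q).

Fixpoint mxAB m (k : 'I_N) (w : word N) : 'M[K]_(mxdim m k, q) :=
  if w is j :: w' then mxA m k j *m mxAB m j w' else mxB m k.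

Definition mxtransfer m : fps N 'M[K]_q :=
  fun w => if w is j :: w' then mxC m j *m mxAB m j w' else mxD m.

Lemma node_ABE m k w c : node_AB (node_of_mx m) k w c = mxAB m k w *m c.
Proof. by elim: w k => [|j w IHw] k //=; rewrite IHw mulmxA. Qed.

Lemma transferE m w c : transfer (node_of_mx m) w c = mxtransfer m w *m c.
Proof. by case: w => [|j w] //=; rewrite node_ABE mulmxA. Qed.

Lemma mx_GR_realization m F :
  GR_realization (node_of_mx m) F <-> mxtransfer m =1 F.
Proof.
split=> [rF w|mF w c]; last by rewrite transferE mF.
apply/matrixP => i j; have /matrixP /(_ i ord0) := rF w (delta_mx j ord0).
by rewrite transferE -!colE !mxE.
Qed.

Lemma mxAA_cat m j w k v :
  mxAA m j w k *m mxAB m k v = mxAB m j (w ++ k :: v).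
Proof. by elim: w j => [|i w IHw] j //=; rewrite -mulmxA IHw. Qed.

Lemma mxCA_AB m w k v : mxCA m w k *m mxAB m k v = mxtransfer m (w ++ k :: v).
Proof. by case: w => [|j w] //=; rewrite -mulmxA mxAA_cat. Qed.

Lemma mxAA_rcons m j w k l :
  mxAA m j (rcons w k) l = mxAA m j w k *m mxA m k l.
Proof. by elim: w j => [|i w IHw] j //=; rewrite IHw mulmxA. Qed.

Lemma mxCA_rcons m w k l : mxCA m (rcons w k) l = mxCA m w k *m mxA m k l.
Proof. by case: w => [|j w] //=; rewrite mxAA_rcons mulmxA. Qed.

(** Annihilator form of the statement that the columns of all [mxAB m k w] span the k-th state
    space; equality of matrices can then be tested on these columns. *)
Definition reachable m : Prop :=
  forall k (x : 'rV_(mxdim m k)), (forall w, x *m mxAB m k w = 0) -> x = 0.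

Definition observable m : Prop :=
  forall k (x : 'cV_(mxdim m k)), (forall w, mxCA m w k *m x = 0) -> x = 0.

Lemma reachable_inj m k p (X Y : 'M[K]_(p, mxdim m k)) : reachable m ->
  (forall w, X *m mxAB m k w = Y *m mxAB m k w) -> X = Y.
Proof.
move=> rm XY; apply/eqP; rewrite -subr_eq0; apply/eqP/row_matrixP => i.
rewrite row0; apply: rm => w.
by rewrite -row_mul mulmxBl XY subrr row0.
Qed.

Lemma observable_inj m k p (X Y : 'M[K]_(mxdim m k, p)) : observable m ->
  (forall w, mxCA m w k *m X = mxCA m w k *m Y) -> X = Y.
Proof.
move=> om XY; suff XY0 j : col j (X - Y) = 0.
  by apply/matrixP => i j; have /colP/(_ i) := XY0 j; rewrite !mxE => /subr0_eq.
by apply: om => w; rewrite -col_mul mulmxBr XY subrr col0.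
Qed.

Lemma reachable_basis m k : reachable m ->
  exists s : 'I_(mxdim m k) -> word N * 'I_q,
    \matrix_i (col (s i).2 (mxAB m k (s i).1))^T \in unitmx.
Proof.
move=> rm; apply: (@basis_extract K _ _ (fun t => (col t.2 (mxAB m k t.1))^T)).
move=> x xAB; apply: (can_inj trmxK); rewrite trmx0; apply: rm => w.
apply: (can_inj trmxK); rewrite trmx_mul trmxK trmx0.
apply/row_matrixP => i; rewrite row0 row_mul -tr_col.
exact: (xAB (w, i)).
Qed.

Lemma observable_basis m k : observable m ->
  exists s : 'I_(mxdim m k) -> word N * 'I_q,
    \matrix_i row (s i).2 (mxCA m (s i).1 k) \in unitmx.
Proof.
move=> om; apply: (@basis_extract K _ _ (fun t => row t.2 (mxCA m t.1 k))).
move=> x xCA; apply: om => w.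
by apply/row_matrixP => i; rewrite row0 row_mul (xCA (w, i)).
Qed.

(** Restrict the node to its reachable subspaces: the columns of [S k] are a basis of reachable
    vectors and [L k] is a left inverse. Observability survives because [S k] is injective and
    intertwines the state-to-output maps. *)
Lemma reach_reduce m : exists m',
  [/\ mxtransfer m' =1 mxtransfer m, reachable m' & observable m -> observable m'].
Proof.
pose v k (t : word N * 'I_q) := (col t.2 (mxAB m k t.1))^T.
pose r k := sval (cid (span_finite (v k))).
pose s k : 'I_(r k) -> word N * 'I_q := sval (cid (svalP (cid (span_finite (v k))))).
have sP k : row_free (\matrix_i v k (s k i)) /\
    forall t, (v k t <= \matrix_j v k (s k j))%MS.
  exact: svalP (cid (svalP (cid (span_finite (v k))))).
pose S k := (\matrix_i v k (s k i))^T.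
pose L k := (pinvmx (\matrix_i v k (s k i)))^T.
have LS k : L k *m S k = 1%:M.
  by rewrite -trmx_mul mulmxVp ?trmx1 //; case: (sP k).
have colS k i : col i (S k) = col (s k i).2 (mxAB m k (s k i).1).
  by rewrite -tr_row rowK trmxK.
(* [S k *m L k] is a projection onto the reachable subspace. *)
have SLAB k w : S k *m L k *m mxAB m k w = mxAB m k w.
  apply: (can_inj trmxK); apply/row_matrixP => i.
  rewrite !trmx_mul !trmxK row_mul -tr_col.
  by rewrite (mulmxA _ _ (\matrix_j _)) mulmxKpV //; case: (sP k) => _ /(_ (w, i)).
(* The reachable subspaces are invariant: [mxA m k j] sends a column for the word v to the column
   for [j :: v]. *)
have SLAS k j : S k *m L k *m mxA m k j *m S j = mxA m k j *m S j.
  apply: (can_inj trmxK); apply/row_matrixP => i.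
  rewrite -!tr_col; congr trmx; rewrite -!mulmxA !col_mul colS -!col_mul.
  by congr col; rewrite mulmxA; exact: (SLAB k (j :: (s j i).1)).
pose m' := @MxNode K N q r (fun i j => L i *m mxA m i j *m S j)
  (fun i => L i *m mxB m i) (fun j => mxC m j *m S j) (mxD m).
have AB' w k : mxAB m' k w = L k *m mxAB m k w.
  elim: w k => [|j w IHw] k //=.
  by rewrite IHw -!mulmxA; congr (_ *m (_ *m _)); rewrite mulmxA SLAB.
have AA' w j k : S j *m mxAA m' j w k = mxAA m j w k *m S k.
  elim: w j => [|i w IHw] j /=; first by rewrite !mulmxA SLAS.
  by rewrite !mulmxA SLAS -mulmxA IHw mulmxA.
exists m'; split.
- by case=> [|j w] //=; rewrite AB' -mulmxA; congr (_ *m _); rewrite mulmxA SLAB.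
- move=> k x xAB; rewrite -[x]mulmx1 -LS mulmxA.
  apply: (can_inj trmxK); apply/row_matrixP => i; rewrite trmx0 row0 -tr_col.
  by rewrite col_mul colS -col_mul -mulmxA -AB' xAB col0 trmx0.
move=> om k x CAx; suff Sx : S k *m x = 0.
  by rewrite -[x]mul1mx -LS -mulmxA Sx mulmx0.
apply: om => w; rewrite mulmxA -(CAx w); congr (_ *m _).
by case: w => [|j w] //=; rewrite -!mulmxA AA'.
Qed.

End MatrixNodes.

Lemma ctrM (K : numClosedFieldType) m n p (A : 'M[K]_(m, n)) (B : 'M_(n, p)) :
  ctr (A *m B) = ctr B *m ctr A.
Proof. by rewrite trmx_mul map_mxM. Qed.

Lemma ctrK (K : numClosedFieldType) m n (A : 'M[K]_(m, n)) : ctr (ctr A) = A.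
Proof. by apply/matrixP => i j; rewrite !mxE conjCK. Qed.

Lemma ctrB (K : numClosedFieldType) m n (A B : 'M[K]_(m, n)) :
  ctr (A - B) = ctr A - ctr B.
Proof. by rewrite !raddfB. Qed.

Lemma ctrN (K : numClosedFieldType) m n (A : 'M[K]_(m, n)) : ctr (- A) = - ctr A.
Proof. by rewrite !raddfN. Qed.

Lemma ctr0 (K : numClosedFieldType) m n : ctr (0 : 'M[K]_(m, n)) = 0.
Proof. by rewrite !raddf0. Qed.

Section AdjointNode.
Variables (K : numClosedFieldType) (N q : nat).
Implicit Types (m : mxnode K N q) (J : 'M[K]_q).

(** At a skew-Hermitian tuple the adjoint of Z^w is (-1)^|w| Z^{rev w}, so this series formally
    takes there the adjoint of the value of F. *)
Definition adjfps p r (F : fps N 'M[K]_(p, r)) : fps N 'M[K]_(r, p) :=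
  fun w => (-1) ^+ size w *: ctr (F (rev w)).

Lemma adjfpsK p r (F : fps N 'M[K]_(p, r)) w : adjfps (adjfps F) w = F w.
Proof.
rewrite /adjfps size_rev revK; apply/matrixP => i j; rewrite !mxE.
by rewrite rmorphM rmorphXn rmorphN1 /= conjCK mulrA -expr2 sqrr_sign mul1r.
Qed.

(** A realization of J F^# J. Adjoints exchange input-to-state and state-to-output maps, hence
    reachability and observability, for invertible [J]. *)
Definition adjnode J m : mxnode K N q :=
  @MxNode K N q (mxdim m) (fun i j => - ctr (mxA m j i))
    (fun i => ctr (mxC m i) *m J) (fun j => - (J *m ctr (mxB m j)))
    (J *m ctr (mxD m) *m J).

Lemma adjnodeAB J m k w :
  mxAB (adjnode J m) k w = (-1) ^+ size w *: (ctr (mxCA m (rev w) k) *m J).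
Proof.
elim: w k => [|j w IHw] k /=; first by rewrite expr0 scale1r.
rewrite IHw rev_cons mxCA_rcons ctrM exprS mulN1r scaleNr mulNmx.
by rewrite -scalemxAr !mulmxA.
Qed.

Lemma adjnodeAA J m j k w :
  mxAA (adjnode J m) j w k = - ((-1) ^+ size w *: ctr (mxAA m k (rev w) j)).
Proof.
elim: w j => [|i w IHw] j /=; first by rewrite expr0 scale1r.
rewrite IHw rev_cons mxAA_rcons ctrM exprS mulN1r scaleNr mulNmx mulmxN.
by rewrite -scalemxAr.
Qed.

Lemma adjnode_transfer J m w :
  mxtransfer (adjnode J m) w = J *m adjfps (mxtransfer m) w *m J.
Proof.
case: w => [|j w] /=; first by rewrite /adjfps expr0 scale1r.
rewrite adjnodeAB /adjfps rev_cons -cats1 -mxCA_AB ctrM /=.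
by rewrite exprS mulN1r scaleNr mulNmx mulmxN mulNmx -!scalemxAr -scalemxAl !mulmxA.
Qed.

Lemma adjnodeCA J m k w :
  mxCA (adjnode J m) w k = - ((-1) ^+ size w *: (J *m ctr (mxAB m k (rev w)))).
Proof.
case: w => [|j w] /=; first by rewrite expr0 scale1r.
rewrite adjnodeAA rev_cons -cats1 -mxAA_cat ctrM /=.
by rewrite exprS mulN1r scaleNr mulNmx mulmxN !opprK -scalemxAr mulmxA.
Qed.

Lemma adjnode_reachable J m : J \in unitmx -> observable m ->
  reachable (adjnode J m).
Proof.
move=> uJ om k x xAB; rewrite -[x]ctrK (om _ (ctr x)) ?ctr0 // => w.
have := xAB (rev w); rewrite adjnodeAB revK -scalemxAr => /eqP.
rewrite scaler_eq0 signr_eq0 /= mulmxA => /eqP xJ.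
by rewrite -[mxCA m w k]ctrK -ctrM -[x *m _](mulmxK uJ) xJ mul0mx ctr0.
Qed.

Lemma adjnode_observable J m : J \in unitmx -> reachable m ->
  observable (adjnode J m).
Proof.
move=> uJ rm k x xCA; rewrite -[x]ctrK (rm _ (ctr x)) ?ctr0 // => w.
have := xCA (rev w); rewrite adjnodeCA revK mulNmx -scalemxAl => /eqP.
rewrite oppr_eq0 scaler_eq0 signr_eq0 /= -mulmxA => /eqP xJ.
by rewrite -[mxAB m k w]ctrK -ctrM -[_ *m x](mulKmx uJ) xJ mulmx0 ctr0.
Qed.

(** Reduce to a reachable node, dualize with J = 1 to an observable one, reduce again keeping
    observability, and dualize back. *)
Lemma reachable_observable_exists m :
  exists m', [/\ mxtransfer m' =1 mxtransfer m, reachable m' & observable m'].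
Proof.
have u1 : (1%:M : 'M[K]_q) \in unitmx by rewrite unitmx1.
have [m1 [t1 r1 _]] := reach_reduce m.
have [m2 [t2 r2 o2]] := reach_reduce (adjnode 1%:M m1).
exists (adjnode 1%:M m2); split.
- move=> w; rewrite adjnode_transfer mul1mx mulmx1 -t1 -[RHS]adjfpsK /adjfps.
  by rewrite t2 adjnode_transfer mul1mx mulmx1.
- exact/adjnode_reachable/o2/adjnode_observable.
exact: adjnode_observable.
Qed.

End AdjointNode.

(** * Minimality and intertwiners *)

Section Minimality.
Import VectorInternalTheory.
Variables (K : numClosedFieldType) (N q : nat).
Implicit Types (m : mxnode K N q) (F : fps N 'M[K]_q).

Lemma recognizable_realization F :
  recognizable F -> exists m, mxtransfer m =1 F.
Proof.
move=> [n [M [c [G [GM Gc]]]]].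
(* All state spaces are copies of one space; [mxAB] at w is then [G w] for every index, and the
   first letter is absorbed into the output matrix. *)
pose m := @MxNode K N q (fun=> n) (fun _ j => M j) (fun=> G [::])
  (fun j => c *m M j) (F [::]).
exists m; case=> [|j w] //=.
rewrite Gc GM mulmxA; congr (_ *m _).
by elim: w j => [|i w IHw] j //=; rewrite IHw GM.
Qed.

Lemma vect_node_mx (b : GRnode K N q) : exists m,
  (forall k, mxdim m k = \dim {:state b k}) /\
  forall w c, transfer b w c = mxtransfer m w *m c.
Proof.
(* [v2r] gives row coordinates with matrices acting on the right; the transposes restore the column
   convention. *)
pose cA i j := (lin1_mx (v2r \o nodeA b i j \o r2v))^T.
pose cB i := (lin1_mx (v2r \o nodeB b i \o trmx))^T.
pose cC j := (lin1_mx (trmx \o nodeC b j \o r2v))^T.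
pose cD := (lin1_mx (trmx \o nodeD b \o trmx))^T.
pose m := @MxNode K N q (fun k => dim (state b k)) cA cB cC cD.
have AB w c k : v2r (node_AB b k w c) = (mxAB m k w *m c)^T.
  elim: w k => [|j w IHw] k /=.
    by rewrite trmx_mul trmxK mul_rV_lin1 /= trmxK.
  by rewrite -mulmxA trmx_mul trmxK -IHw mul_rV_lin1 /= v2rK.
exists m; split=> [k|]; first by rewrite dimvf.
case=> [|j w] c /=; apply: (can_inj trmxK).
  by rewrite trmx_mul trmxK mul_rV_lin1 /= trmxK.
by rewrite -mulmxA trmx_mul trmxK -AB mul_rV_lin1 /= v2rK.
Qed.

(* The Hankel block at [k], with rows u and columns v, has entries F_{u g_k v};
   it factors through the state space of every realization of F. *)
Lemma hankel_rank m0 m k :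
  reachable m0 -> observable m0 -> mxtransfer m0 =1 mxtransfer m ->
  (mxdim m0 k <= mxdim m k)%N /\
  ((mxdim m k <= mxdim m0 k)%N ->
    forall x : 'cV_(mxdim m k), (forall w, mxCA m w k *m x = 0) -> x = 0).
Proof.
move=> r0 o0 t0m.
have [s us] := observable_basis k o0; have [t ut] := reachable_basis k r0.
pose O m' := \matrix_i row (s i).2 (mxCA m' (s i).1 k).
pose S m' := (\matrix_i (col (t i).2 (mxAB m' k (t i).1))^T)^T.
have hankel m' :
    O m' *m S m' = \matrix_(i, j) mxtransfer m' ((s i).1 ++ k :: (t j).1) (s i).2 (t j).2.
  apply/matrixP => i j; rewrite [RHS]mxE -mxCA_AB !mxE.
  by apply: eq_bigr => l _; rewrite !mxE.
have OS : O m0 *m S m0 = O m *m S m.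
  by rewrite !hankel; apply/matrixP => i j; rewrite !mxE t0m.
(* The selected rows and columns are bases for [m0], so this Hankel matrix is invertible, yet it
   factors through [O m]. *)
have rO : (mxdim m0 k <= \rank (O m))%N.
  have /mxrank_unit rk : O m0 *m S m0 \in unitmx.
    by rewrite unitmx_mul us unitmx_tr ut.
  by rewrite -[leqLHS]rk OS mxrankM_maxl.
split=> [|le_m x CAx]; first exact: leq_trans rO (rank_leq_col _).
(* Without excess dimension [O m] has full column rank, hence a left inverse. *)
have fO : row_full (O m).
  by rewrite /row_full eqn_leq rank_leq_col (leq_trans le_m).
rewrite -[x]mul1mx -(mulVpmx fO) -mulmxA [X in _ *m X](_ : _ = 0) ?mulmx0 //.
by apply/row_matrixP => i; rewrite row0 row_mul rowK -row_mul CAx row0.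
Qed.

Lemma dim_colvec n : \dim {:'cV[K]_n} = n.
Proof. by rewrite dimvf /dim /= muln1. Qed.

Lemma reachable_observable_minimal m F : mxtransfer m =1 F ->
  reachable m -> observable m -> minimal_GR_realization (node_of_mx m) F.
Proof.
move=> mF rm om; split=> [|b bF k]; first exact/mx_GR_realization.
have [m' [dm' tm']] := vect_node_mx b.
rewrite dim_colvec -dm'; apply: (hankel_rank k rm om _).1 => w.
have /mx_GR_realization -> // : GR_realization (node_of_mx m') F.
by move=> v c; rewrite transferE -tm' bF.
Qed.

(** Minimality bounds the dimensions by those of a reachable and observable realization, which is
    the equality case of [hankel_rank]. *)
Lemma minimal_observable m F :
  minimal_GR_realization (node_of_mx m) F -> observable m.
Proof.
move=> [mF minm] k; have [m0 [t0 r0 o0]] := reachable_observable_exists m.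
apply: (hankel_rank k r0 o0 t0).2.
move/mx_GR_realization: mF => mF.
have /minm/(_ k) : GR_realization (node_of_mx m0) F.
  by apply/mx_GR_realization => w; rewrite t0 mF.
by rewrite !dim_colvec.
Qed.

End Minimality.

Section Intertwiners.
Variables (K : numClosedFieldType) (N q : nat).
Implicit Types (m : mxnode K N q).

(** [T] is fixed by its values on a basis of reachable vectors of [m1]. The common transfer series
    makes it respect the state-to-output maps, and observability of [m2] then settles all words. *)
Lemma intertwiner_exists m1 m2 :
  reachable m1 -> observable m2 -> mxtransfer m1 =1 mxtransfer m2 ->
  exists T : forall k, 'M[K]_(mxdim m2 k, mxdim m1 k),
    forall k w, T k *m mxAB m1 k w = mxAB m2 k w.
Proof.
move=> r1 o2 t12.
suff exT k : exists T : 'M[K]_(mxdim m2 k, mxdim m1 k),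
    forall w, T *m mxAB m1 k w = mxAB m2 k w.
  by exists (fun k => sval (cid (exT k))) => k; apply: svalP (cid (exT k)).
have [t ut] := reachable_basis k r1.
pose S m' := (\matrix_i (col (t i).2 (mxAB m' k (t i).1))^T)^T.
have uS : S m1 \in unitmx by rewrite unitmx_tr.
have colS m' i : col i (S m') = col (t i).2 (mxAB m' k (t i).1).
  by rewrite -tr_row rowK trmxK.
pose T := S m2 *m invmx (S m1).
have TCA u : mxCA m2 u k *m T = mxCA m1 u k.
  rewrite mulmxA; apply: (can_inj (mulmxK uS)); rewrite mulmxKV //.
  apply/matrixP => a i; have /colP/(_ a) :
      col i (mxCA m2 u k *m S m2) = col i (mxCA m1 u k *m S m1).
    by rewrite !col_mul !colS -!col_mul !mxCA_AB t12.
  by rewrite !mxE.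
exists T => w; apply: (observable_inj o2) => u.
by rewrite mulmxA TCA !mxCA_AB t12.
Qed.

Lemma intertwiner_A m1 m2 (T : forall k, 'M[K]_(mxdim m2 k, mxdim m1 k)) :
  reachable m1 -> (forall k w, T k *m mxAB m1 k w = mxAB m2 k w) ->
  forall k j, T k *m mxA m1 k j = mxA m2 k j *m T j.
Proof.
move=> r1 TAB k j; apply: (reachable_inj r1) => w.
by rewrite -!mulmxA TAB (TAB k (j :: w)).
Qed.

Lemma intertwiner_C m1 m2 (T : forall k, 'M[K]_(mxdim m2 k, mxdim m1 k)) :
  reachable m1 -> mxtransfer m1 =1 mxtransfer m2 ->
  (forall k w, T k *m mxAB m1 k w = mxAB m2 k w) ->
  forall j, mxC m1 j = mxC m2 j *m T j.
Proof.
move=> r1 t12 TAB j; apply: (reachable_inj r1) => w.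
by rewrite -mulmxA TAB; exact: (t12 (j :: w)).
Qed.

(** * The inverse node and the associated Hermitian matrix *)

Definition invnode m : mxnode K N q :=
  @MxNode K N q (mxdim m)
    (fun i j => mxA m i j - mxB m i *m invmx (mxD m) *m mxC m j)
    (fun i => mxB m i *m invmx (mxD m)) (fun j => - (invmx (mxD m) *m mxC m j))
    (invmx (mxD m)).

(** In the convolution, the empty prefix contributes B D^{-1} C_j times [mxAB m j w], which restores
    what A - B D^{-1} C subtracts. *)
Lemma invnodeAB m k w : mxD m \in unitmx ->
  conv (mxAB (invnode m) k) (mxtransfer m) w = mxAB m k w.
Proof.
move=> uD; elim: w k => [|j w IHw] k; first by rewrite conv_nil /= mulmxKV.
rewrite conv_cons /= conv_mull IHw mulmxBl !mulmxA.
by rewrite addrC subrK.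
Qed.

Lemma invnode_transfer m : mxD m \in unitmx ->
  conv (mxtransfer (invnode m)) (mxtransfer m) =1 @conv1 K N q.
Proof.
move=> uD [|j w]; first by rewrite conv_nil /= mulVmx.
by rewrite conv_cons /= conv_mull invnodeAB // mulNmx mulmxA subrr.
Qed.

Lemma invnode_reachable m : mxD m \in unitmx -> reachable m ->
  reachable (invnode m).
Proof.
move=> uD rm k x xAB; apply: rm => w.
rewrite -invnodeAB // -conv_mull /conv big1 // => i _.
by rewrite xAB mul0mx.
Qed.

Lemma associated_hermitian_exists (J : 'M[K]_q) m :
  signature_mx J -> reachable m -> observable m ->
  (forall w, conv (mxtransfer m) (fun u => J *m adjfps (mxtransfer m) u) w =
             if w is [::] then J else 0) ->
  exists H : forall k, 'M[K]_(mxdim m k), associated_hermitian J H.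
Proof.
move=> [hJ JJ] rm om FJF.
have uJ : J \in unitmx by case/mulmx1_unit: JJ.
have FG : conv (mxtransfer m) (mxtransfer (adjnode J m)) =1 @conv1 K N q.
  move=> w; rewrite (eq_conv (fun=> erefl) (@adjnode_transfer _ _ _ J m)).
  by rewrite conv_mulr FJF; case: w => [|j w]; rewrite ?JJ ?mul0mx.
have DD : mxD m *m (J *m ctr (mxD m) *m J) = 1%:M.
  by have := FG [::]; rewrite conv_nil.
have [uD _] := mulmx1_unit DD.
have Dinv : invmx (mxD m) = J *m ctr (mxD m) *m J.
  by rewrite -[LHS]mulmx1 -DD mulKmx.
have ri := invnode_reachable uD rm.
(* The inverse node gives a left inverse and the adjoint node a right inverse of the same series. *)
have t12 := conv_inv_uniq (invnode_transfer uD) FG.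
have [T TAB] : exists T : forall k, 'M[K]_(mxdim m k),
    forall k w, T k *m mxAB (invnode m) k w = mxAB (adjnode J m) k w.
  apply: (@intertwiner_exists (invnode m) (adjnode J m)) => //.
  exact: adjnode_observable.
have eA i j : T i *m (mxA m i j - mxB m i *m invmx (mxD m) *m mxC m j) =
    - ctr (mxA m j i) *m T j.
  exact: (@intertwiner_A (invnode m) (adjnode J m)).
have eB i : T i *m (mxB m i *m invmx (mxD m)) = ctr (mxC m i) *m J.
  exact: (TAB i [::]).
have eC j : invmx (mxD m) *m mxC m j = J *m ctr (mxB m j) *m T j.
  apply: oppr_inj; rewrite -[RHS]mulNmx.
  exact: (@intertwiner_C (invnode m) (adjnode J m)).
(* The adjoints of [eA], [eB] and [eC] show that the adjoint of [T] intertwines the same two nodes;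
   reachability makes the intertwiner unique. *)
have hT k : ctr (T k) = T k.
  suff {k} TAB' w k : ctr (T k) *m mxAB (invnode m) k w = mxAB (adjnode J m) k w.
    by apply: (reachable_inj ri) => w; rewrite TAB' TAB.
  have eTB i : ctr (T i) *m mxB m i = ctr (mxC m i) *m J *m mxD m.
    have := congr1 (fun X => ctr X *m J) (eC i).
    by rewrite /= !ctrM ctrK hJ Dinv !ctrM ctrK hJ -!mulmxA JJ !mulmx1 => <-.
  have eTA i j : ctr (T i) *m (mxA m i j - mxB m i *m invmx (mxD m) *m mxC m j) =
      - ctr (mxA m j i) *m ctr (T j).
    have := congr1 (fun X => ctr X) (eB j); rewrite !ctrM ctrK hJ => eBj.
    have := congr1 (fun X => ctr X) (eA j i).
    rewrite !ctrM ctrB ctrN ctrK !ctrM mulmxBl -!mulmxA [ctr (invmx _) *m _]mulmxA.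
    rewrite eBj mulmxN mulNmx => /eqP; rewrite subr_eq => /eqP ->.
    by rewrite mulmxBr !mulmxA eTB mulmxK // opprD opprK -!mulmxA.
  elim: w k => [|j w IHw] k /=; first by rewrite mulmxA eTB mulmxK.
  by rewrite mulmxA eTA -mulmxA IHw.
(* A row killing [T k] kills every reachable vector of the adjoint node. *)
have uT k : T k \in unitmx.
  rewrite -row_free_unit -kermx_eq0; apply/eqP.
  apply: (reachable_inj (adjnode_reachable uJ om)) => w.
  by rewrite -TAB mulmxA mulmx_ker !mul0mx.
have uNT k : - T k \in unitmx by rewrite -scaleN1r unitmxZ // unitrN1.
(* The sign is forced: [eA] and [eB] give A^* T + T A = C^* J C and T B = C^* J D. *)
exists (fun k => - T k); split.
- by move=> k; split; [rewrite /Defs.hermitian ctrN hT | exact: uNT].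
- move=> i j; rewrite mulmxN mulNmx -opprD; congr (- _).
  have /eqP := eA i j; rewrite mulmxBr subr_eq => /eqP ->.
  by rewrite !mulmxA -(mulmxA (T i)) eB mulNmx addNKr.
move=> k; rewrite -[LHS](mulKmx (uNT k)) -!mulmxA -mulmxN; congr (_ *m _).
rewrite mulNmx; congr (- _).
by rewrite -[LHS](mulmxKV uD) -(mulmxA (T k)) eB mulmxA.
Qed.

End Intertwiners.

(** * Evaluation of rational expressions *)

Section Evaluation.
Variables (K : numClosedFieldType) (N : nat).
Implicit Types e : rexp K N.

Lemma eval_rexp_uniq n (Z : 'I_N -> 'M[K]_n) e M1 M2 :
  eval_rexp Z e M1 -> eval_rexp Z e M2 -> M1 = M2.
Proof.
elim: e M1 M2 => [c|k|e1 IH1 e2 IH2|e1 IH1 e2 IH2|e1 IH1] M1 M2 /=.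
- by move=> -> ->.
- by move=> -> ->.
- move=> [A1 [A2 [a1 a2 ->]]] [B1 [B2 [b1 b2 ->]]].
  by rewrite (IH1 _ _ a1 b1) (IH2 _ _ a2 b2).
- move=> [A1 [A2 [a1 a2 ->]]] [B1 [B2 [b1 b2 ->]]].
  by rewrite (IH1 _ _ a1 b1) (IH2 _ _ a2 b2).
by move=> [A [a _ ->]] [B [b _ ->]]; rewrite (IH1 _ _ a b).
Qed.

Lemma eval_rexp_conj n (P : 'M[K]_n) (Z : 'I_N -> 'M[K]_n) e M : P \in unitmx ->
  eval_rexp Z e M ->
  eval_rexp (fun k => P *m Z k *m invmx P) e (P *m M *m invmx P).
Proof.
move=> uP; elim: e M => [c|k|e1 IH1 e2 IH2|e1 IH1 e2 IH2|e1 IH1] M /=.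
- by move=> ->; rewrite scalar_mxC mulmxK.
- by move=> ->.
- move=> [A1 [A2 [/IH1 a1 /IH2 a2 ->]]].
  exists (P *m A1 *m invmx P), (P *m A2 *m invmx P); split=> //.
  by rewrite mulmxDr mulmxDl.
- move=> [A1 [A2 [/IH1 a1 /IH2 a2 ->]]].
  exists (P *m A1 *m invmx P), (P *m A2 *m invmx P); split=> //.
  by rewrite !mulmxA mulmxKV.
move=> [A [/IH1 a uA ->]]; exists (P *m A *m invmx P).
have uPA : P *m A *m invmx P \in unitmx by rewrite !unitmx_mul uP uA unitmx_inv.
split=> //; rewrite -[LHS](mulmxK uPA) -[RHS]mul1mx; congr (_ *m _).
by rewrite !mulmxA mulmxKV // mulmxKV // mulmxV.
Qed.

(** Along a polynomial curve the value is a rational function P/d, the inverses being written with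
    adjugates; definedness at 0 is what keeps d(0) non-zero. *)
Lemma eval_rexp_poly n (Z : 'I_N -> 'M[{poly K}]_n) e M0 :
  eval_rexp (fun k => map_mx (horner_eval 0) (Z k)) e M0 ->
  exists (d : {poly K}) (P : 'M[{poly K}]_n), d.[0] != 0 /\
    forall s, d.[s] != 0 -> eval_rexp (fun k => map_mx (horner_eval s) (Z k)) e
                              (d.[s]^-1 *: map_mx (horner_eval s) P).
Proof.
elim: e M0 => [c|k|e1 IH1 e2 IH2|e1 IH1 e2 IH2|e1 IH1] M0 /=.
- move=> _; exists 1, (c%:P)%:M; rewrite hornerC oner_neq0; split=> // s _.
  by rewrite hornerC invr1 scale1r map_scalar_mx /= /horner_eval hornerC.
- move=> _; exists 1, (Z k); rewrite hornerC oner_neq0; split=> // s _.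
  by rewrite hornerC invr1 scale1r.
- move=> [A1 [A2 [/IH1[d1 [P1 [n1 e1P]]] /IH2[d2 [P2 [n2 e2P]]] _]]].
  exists (d1 * d2), (d2 *: P1 + d1 *: P2); rewrite hornerM mulf_neq0 //; split=> // s.
  rewrite hornerM mulf_eq0 negb_or => /andP[s1 s2].
  do 2 eexists; split; [exact: e1P | exact: e2P |].
  rewrite map_mxD !map_mxZ /= /horner_eval scalerDr !scalerA invfM.
  by rewrite divfK // mulrAC mulVf // mul1r.
- move=> [A1 [A2 [/IH1[d1 [P1 [n1 e1P]]] /IH2[d2 [P2 [n2 e2P]]] _]]].
  exists (d1 * d2), (P1 *m P2); rewrite hornerM mulf_neq0 //; split=> // s.
  rewrite hornerM mulf_eq0 negb_or => /andP[s1 s2].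
  do 2 eexists; split; [exact: e1P | exact: e2P |].
  by rewrite map_mxM /= -scalemxAl -scalemxAr scalerA invfM.
move=> [A [eA uA _]]; have [d1 [P1 [n1 e1P]]] := IH1 _ eA.
(* The inverse of P1/d1 is d1 adj(P1)/det(P1); the additional factor [d1] in the denominator keeps
   the inner expression defined. *)
exists (d1 * \det P1), ((d1 * d1) *: \adj P1).
have detE s : (\det P1).[s] = \det (map_mx (horner_eval s) P1).
  by rewrite det_map_mx.
split.
  rewrite hornerM mulf_neq0 // detE; have := uA.
  rewrite (eval_rexp_uniq eA (e1P 0 n1)) unitmxZ ?unitfE ?invr_eq0 //.
  by rewrite unitmxE unitfE.
move=> s; rewrite hornerM mulf_eq0 negb_or => /andP[s1 s2].
have u1 : d1.[s]^-1 *: map_mx (horner_eval s) P1 \in unitmx.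
  by rewrite unitmxZ ?unitfE ?invr_eq0 // unitmxE unitfE -detE.
eexists; split; [exact: e1P | exact: u1 |].
rewrite invmxZ // invrK map_mxZ map_mx_adj /= /horner_eval hornerM.
rewrite /invmx unitmxE unitfE -detE s2 !scalerA; congr (_ *: _).
by rewrite invfM mulrACA mulVf // mul1r mulrC.
Qed.

(** * Path matrices and the vanishing of series *)

Section PathMatrices.
Variable w : word N.

(* The weighted adjacency matrix, restricted to the edges labelled [k], of the
   path 0 - 1 - ... - n whose consecutive edges are labelled by the letters of w. *)
Definition path_mx (R : pzRingType) (u l : R) (k : 'I_N) : 'M[R]_((size w).+1) :=
  \matrix_(a, b) (u *+ ((b == a.+1 :> nat) && (take 1 (drop a w) == [:: k]))
                + l *+ ((a == b.+1 :> nat) && (take 1 (drop b w) == [:: k]))).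

(** Entry (a, b) is the coefficient at the factor of [w] between positions a and b. This is the
    value of [f] at the nilpotent tuple [path_mx 1 0], with [f w] in the corner. *)
Definition slice_mx (f : fps N K) : 'M[K]_((size w).+1) :=
  \matrix_(a, b) (if (a <= b)%N then f (take (b - a) (drop a w)) else 0).

Lemma size_slice a b : (b <= size w)%N -> size (take (b - a) (drop a w)) = (b - a)%N.
Proof. by move=> bn; rewrite size_takel // size_drop leq_sub2r. Qed.

(** Factorizations of the slice from a to b correspond to the cut positions c between them, which
    are the inner indices giving non-zero terms of the matrix product. *)
Lemma slice_mxM (f g : fps N K) :
  slice_mx (fps_mul f g) = slice_mx f *m slice_mx g.
Proof.
apply/matrixP => a b; rewrite !mxE.
have bn : (b <= size w)%N by rewrite -ltnS ltn_ord.
pose G c := f (take (c - a) (drop a w)) * g (take (b - c) (drop c w)).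
have -> : \sum_j slice_mx f a j * slice_mx g j b =
    \sum_(0 <= c < (size w).+1 | (a <= c)%N && (c < b.+1)%N) G c.
  rewrite big_mkord [RHS]big_mkcond; apply: eq_bigr => c _; rewrite !mxE ltnS.
  by case: (a <= c)%N; case: (c <= b)%N; rewrite ?mul0r ?mulr0.
have -> : \sum_(0 <= c < (size w).+1 | (a <= c)%N && (c < b.+1)%N) G c =
    \sum_(a <= c < b.+1) G c.
  by rewrite [RHS](big_nat_widenl _ 0) // [RHS](big_nat_widen _ _ (size w).+1).
case: leqP => ab; last by rewrite big_geq.
rewrite -[X in bigop.body _ (index_iota X _)]add0n big_addn big_mkord /fps_mul.
rewrite size_slice // subSn //; apply: eq_bigr => i _.
have ib : (i <= b - a)%N by rewrite -ltnS ltn_ord.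
rewrite /G addnK take_takel //; congr (_ * g _).
rewrite -drop_drop [RHS]take_drop; congr (drop _ (take _ _)).
by rewrite [(i + a)%N]addnC subnDA subnK.
Qed.

Lemma slice_mx_const c : slice_mx (fps_const c) = c%:M.
Proof.
apply/matrixP => a b; rewrite !mxE /fps_const.
have bn : (b <= size w)%N by rewrite -ltnS ltn_ord.
case: leqP => ab; last by rewrite -val_eqE gtn_eqF.
have -> : (a == b) = (size (take (b - a) (drop a w)) == 0%N).
  by rewrite size_slice // -val_eqE eqn_leq ab /= subn_eq0.
by case: (take _ _).
Qed.

Lemma slice_mx_var k : slice_mx (@fps_var K N k) = path_mx 1 0 k.
Proof.
apply/matrixP => a b; rewrite !mxE /fps_var mul0rn addr0.
have bn : (b <= size w)%N by rewrite -ltnS ltn_ord.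
have [->|/eqP ba] := eqVneq (nat_of_ord b) a.+1; first by rewrite leqnSn subSnn.
case: leqP => ab //=; case: eqP => // s1; case: ba.
by have := size_slice a bn; rewrite s1 /= => /(congr1 (addn^~ a)); rewrite subnK.
Qed.

(** [slice_mx] is multiplicative and unital, so an inverse series yields an inverse matrix and [e]
    is defined at this tuple. *)
Lemma eval_path_mx e f : expands e f -> eval_rexp (path_mx 1 0) e (slice_mx f).
Proof.
elim: e f => [c|k|e1 IH1 e2 IH2|e1 IH1 e2 IH2|e1 IH1] f /=.
- by move=> ->; rewrite slice_mx_const.
- by move=> ->; rewrite slice_mx_var.
- move=> [f1 [f2 [/IH1 E1 /IH2 E2 ->]]]; exists (slice_mx f1), (slice_mx f2).
  split=> //; apply/matrixP => a b; rewrite !mxE.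
  by case: ifP; rewrite ?addr0.
- move=> [f1 [f2 [/IH1 E1 /IH2 E2 ->]]]; exists (slice_mx f1), (slice_mx f2).
  by split=> //; apply: slice_mxM.
move=> [f1 [/IH1 E1 _ ff1 f1f]]; exists (slice_mx f1).
have mul1 : slice_mx f1 *m slice_mx f = 1%:M.
  by rewrite -slice_mxM f1f slice_mx_const.
have [u1 _] := mulmx1_unit mul1; split=> //.
by rewrite -[LHS](mulKmx u1) mul1 mulmx1.
Qed.

End PathMatrices.

(** In characteristic 0 the squares of the positive integers are infinitely many distinct roots. *)
Lemma poly_eq0_squares (p : {poly K}) :
  (forall t, p.[t.+1%:R ^+ 2] = 0) -> p = 0.
Proof.
move=> p0; apply/eqP/negPn/negP => nz_p.
pose rs := [seq t.+1%:R ^+ 2 : K | t <- iota 0 (size p)].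
have urs : uniq rs.
  rewrite map_inj_uniq ?iota_uniq // => i j /eqP.
  by rewrite -!natrX eqr_nat eqn_exp2r // => /eqP[].
have rrs : all (root p) rs by apply/allP => _ /mapP[t _ ->]; apply/rootP.
by have := max_poly_roots nz_p rrs urs; rewrite size_map size_iota ltnn.
Qed.

Lemma path_mx_skew w m k :
  ctr (@path_mx w K m%:R (- m%:R) k) = - path_mx w m%:R (- m%:R) k.
Proof.
apply/matrixP => a b; rewrite !mxE rmorphD !rmorphMn rmorphN /= conjC_nat.
by rewrite opprD !mulNrn opprK addrC conjC1.
Qed.

(** Scaling the a-th basis vector by t^a moves the weight t of the upward edges to the downward
    ones. *)
Lemma path_mx_conj w (t : K) k :
  diag_mx (\row_a t ^+ a) *m path_mx w t (- t) k =
  path_mx w 1 (- t ^+ 2) k *m diag_mx (\row_a t ^+ a).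
Proof.
apply/matrixP => a b; rewrite mul_diag_mx mul_mx_diag !mxE.
have [ba|_] := eqVneq (nat_of_ord b) a.+1.
  have -> : (nat_of_ord a == b.+1) = false by rewrite ba ltn_eqF // ltnS leqnSn.
  by rewrite !addr0 mulrnAr mulrnAl ba mul1r exprSr.
rewrite !add0r; have [->|_] := eqVneq (nat_of_ord a) b.+1; last by rewrite mulr0 mul0r.
by rewrite mulrnAr mulrnAl mulrN mulNr exprS mulrAC -expr2.
Qed.

(* For [s = t ^+ 2], [path_mx w 1 (- s)] is similar to a skew-Hermitian matrix,
   so [e] vanishes there; letting [s] tend to 0 along the rational function
   [e (path_mx w 1 (- s))] leaves the nilpotent point, where the corner entry of
   the value is [f w]. *)
Lemma expands_eq0 e f : expands e f ->
  (forall n (Z : 'I_N -> 'M[K]_n) M, (forall k, ctr (Z k) = - Z k) ->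
    eval_rexp Z e M -> M = 0) ->
  forall w, f w = 0.
Proof.
move=> ef e0 w.
pose Z k := path_mx w 1 (- 'X : {poly K}) k.
have ZE s : (fun k => map_mx (horner_eval s) (Z k)) = path_mx w 1 (- s).
  apply: funext => k; apply/matrixP => a b; rewrite !mxE /horner_eval.
  by rewrite hornerD !hornerMn hornerN hornerX hornerC.
have ef0 := eval_path_mx w ef.
have := ef0; rewrite -[X in path_mx w 1 X]oppr0 -ZE => /eval_rexp_poly[d [P [d0 dP]]].
(* The value vanishes at s = t^2 for positive integers t, so each entry of d P vanishes at all these
   s, trivially so at the roots of d; and d is not the zero polynomial. *)
have P0 : P = 0.
  apply/matrixP => a b; rewrite mxE; apply: (@mulfI _ d).
    by apply: contraNneq d0 => ->; rewrite horner0.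
  rewrite mulr0; apply: poly_eq0_squares => m; rewrite hornerM.
  set t := m.+1%:R; have [->|dt] := eqVneq d.[t ^+ 2] 0; first by rewrite mul0r.
  pose T : 'M[K]_((size w).+1) := diag_mx (\row_a t ^+ a).
  have uT : T \in unitmx.
    rewrite unitmxE det_diag unitfE; apply/prodf_neq0 => i _.
    by rewrite mxE expf_neq0 // pnatr_eq0.
  have := dP _ dt; rewrite ZE.
  have uT' : invmx T \in unitmx by rewrite unitmx_inv.
  move/(eval_rexp_conj uT'); rewrite invmxK.
  have -> : (fun k => invmx T *m path_mx w 1 (- t ^+ 2) k *m T) = path_mx w t (- t).
    by apply: funext => k; rewrite -mulmxA -path_mx_conj mulKmx.
  move/e0 => /(_ (path_mx_skew w m.+1))/(congr1 (fun X => T *m X *m invmx T)).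
  rewrite !mulmxA mulmxV // mul1mx mulmxK // mulmx0 mul0mx => /matrixP/(_ a b)/eqP.
  by rewrite !mxE mulf_eq0 invr_eq0 (negPf dt) /horner_eval => /eqP ->; rewrite mulr0.
(* At s = 0 the value is both [slice_mx w f] and 0; compare corner entries. *)
have := dP 0 d0; rewrite ZE oppr0 => /(eval_rexp_uniq ef0).
rewrite P0 map_mx0 scaler0 => /matrixP/(_ ord0 ord_max).
by rewrite !mxE /= drop0 subn0 take_size.
Qed.

(** * Formal adjoints of expressions and series *)

Fixpoint adjexp e : rexp K N :=
  match e with
  | RConst c => RConst N (Num.conj c)
  | RVar k => RMul (RConst N (-1)) (RVar K k)
  | RAdd e1 e2 => RAdd (adjexp e1) (adjexp e2)
  | RMul e1 e2 => RMul (adjexp e2) (adjexp e1)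
  | RInv e1 => RInv (adjexp e1)
  end.

(** The adjoint negates each Z_k, conjugates constants, reverses products and preserves
    invertibility, as [adjexp] does formally. *)
Lemma eval_adjexp n (Z : 'I_N -> 'M[K]_n) e M : (forall k, ctr (Z k) = - Z k) ->
  eval_rexp Z e M -> eval_rexp Z (adjexp e) (ctr M).
Proof.
move=> skZ; elim: e M => [c|k|e1 IH1 e2 IH2|e1 IH1 e2 IH2|e1 IH1] M /=.
- by move=> ->; rewrite tr_scalar_mx map_scalar_mx.
- move=> ->; exists (-1)%:M, (Z k); split=> //.
  by rewrite skZ mul_scalar_mx scaleN1r.
- move=> [A1 [A2 [/IH1 a1 /IH2 a2 ->]]]; exists (ctr A1), (ctr A2); split=> //.
  by rewrite !raddfD.
- move=> [A1 [A2 [/IH1 a1 /IH2 a2 ->]]]; exists (ctr A2), (ctr A1); split=> //.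
  by rewrite ctrM.
move=> [A [/IH1 a uA ->]]; exists (ctr A); split=> //.
  by rewrite map_unitmx unitmx_tr.
by rewrite trmx_inv map_invmx.
Qed.

Definition adjser (f : fps N K) : fps N K :=
  fun w => (-1) ^+ size w * Num.conj (f (rev w)).

Lemma adjser_mul f g : adjser (fps_mul f g) = fps_mul (adjser g) (adjser f).
Proof.
apply: funext => w; rewrite /adjser /fps_mul size_rev rmorph_sum mulr_sumr.
rewrite (reindex_inj rev_ord_inj); apply: eq_bigr => i _ /=.
have iw : (i <= size w)%N by rewrite -ltnS ltn_ord.
rewrite subSS take_rev drop_rev subKn // rmorphM [RHS]mulrACA.
by rewrite -exprD -size_cat cat_take_drop; congr (_ * _); apply: mulrC.
Qed.

Lemma adjser_const c : adjser (fps_const c) = fps_const (Num.conj c).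
Proof.
apply: funext => -[|j w]; first by rewrite /adjser /= mul1r.
rewrite /adjser /fps_const -(size_rev (j :: w)) rev_cons.
by case: (rev w) => [|l v] /=; rewrite rmorph0 mulr0.
Qed.

(** [adjser] is a conjugate-linear anti-automorphism sending z_k to -z_k, so it follows every
    constructor of [adjexp]. *)
Lemma expands_adjexp e f : expands e f -> expands (adjexp e) (adjser f).
Proof.
elim: e f => [c|k|e1 IH1 e2 IH2|e1 IH1 e2 IH2|e1 IH1] f /=.
- by move=> ->; rewrite adjser_const.
- move=> ->; exists (fps_const (-1)), (fps_var K k); split=> //.
  apply: funext => w; rewrite /adjser /fps_mul /fps_var.
  rewrite -[rev w == _](inj_eq (can_inj revK)) revK /=.
  case: w => [|j w]; first by rewrite big_ord1 /= rmorph0 !mulr0.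
  rewrite big_ord_recl /= big1 ?addr0 => [|i _]; last by rewrite /= mul0r.
  rewrite conjC_nat; case: eqP => [[_ ->]|]; last by rewrite !mulr0.
  by rewrite expr1.
- move=> [f1 [f2 [/IH1 E1 /IH2 E2 ->]]]; exists (adjser f1), (adjser f2).
  by split=> //; apply: funext => w; rewrite /adjser rmorphD mulrDr.
- move=> [f1 [f2 [/IH1 E1 /IH2 E2 ->]]]; exists (adjser f2), (adjser f1).
  by split=> //; rewrite adjser_mul.
move=> [f1 [/IH1 E1 f0 ff1 f1f]]; exists (adjser f1); split=> //.
- by rewrite /adjser mul1r conjC_eq0.
- by rewrite -adjser_mul f1f adjser_const conjC1.
by rewrite -adjser_mul ff1 adjser_const conjC1.
Qed.

End Evaluation.

(** * The series identity of matrix-J-unitarity *)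

Section SumExpressions.
Variables (K : numClosedFieldType) (N : nat).

Definition rsum (I : Type) (s : seq I) (E : I -> rexp K N) : rexp K N :=
  foldr (fun i e => RAdd (E i) e) (RConst N 0) s.

Lemma expands_rsum (I : Type) (s : seq I) E (f : I -> fps N K) :
  (forall i, expands (E i) (f i)) ->
  expands (rsum s E) (fun w => \sum_(i <- s) f i w).
Proof.
move=> Ef; elim: s => [|i s IHs] /=.
  by apply: funext => -[|j w]; rewrite big_nil.
exists (f i), (fun w => \sum_(i <- s) f i w); split=> //.
by apply: funext => w; rewrite big_cons.
Qed.

Lemma eval_rsum (I : Type) (s : seq I) E n (Z : 'I_N -> 'M[K]_n) V :
  (forall i, eval_rexp Z (E i) (V i)) ->
  eval_rexp Z (rsum s E) (\sum_(i <- s) V i).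
Proof.
move=> EV; elim: s => [|i s IHs] /=; first by rewrite big_nil raddf0.
by exists (V i), (\sum_(i <- s) V i); split=> //; rewrite big_cons.
Qed.

(** Evaluation is strict: a sum has a value only where each summand has one. *)
Lemma eval_rsum_inv (I : eqType) (s : seq I) E n (Z : 'I_N -> 'M[K]_n) M i :
  eval_rexp Z (rsum s E) M -> i \in s -> exists V, eval_rexp Z (E i) V.
Proof.
elim: s M => [|j s IHs] //= M [V [M' [EV EM' _]]].
by rewrite in_cons => /predU1P[->|/(IHs _ EM')//]; exists V.
Qed.

Lemma fps_mul_constl c (f : fps N K) w : fps_mul (fps_const c) f w = c * f w.
Proof.
rewrite /fps_mul big_ord_recl take0 drop0 big1 ?addr0 // => i _.
by case: w i => [|j w] [m] //= _; rewrite mul0r.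
Qed.

End SumExpressions.

Section Blocks.
Variables (K : numClosedFieldType) (q n : nat).
Implicit Types (A B : 'M[K]_(q * n)) (J : 'M[K]_q).

Definition tensblock A (i j : 'I_q) : 'M[K]_n :=
  \matrix_(a, b) A (mxtens_index (i, a)) (mxtens_index (j, b)).

Lemma tensblockM A B i l :
  tensblock (A *m B) i l = \sum_j tensblock A i j *m tensblock B j l.
Proof.
apply/matrixP => a b; rewrite summxE !mxE.
rewrite (reindex (@mxtens_index q n)) /=; last first.
  by exists (@mxtens_unindex q n) => k _; rewrite (mxtens_indexK, mxtens_unindexK).
pose G j c := A (mxtens_index (i, a)) (mxtens_index (j, c)) *
  B (mxtens_index (j, c)) (mxtens_index (l, b)).
transitivity (\sum_p G p.1 p.2); first by apply: eq_bigr => -[].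
rewrite -(pair_bigA _ G); apply: eq_bigr => j _; rewrite mxE.
by apply: eq_bigr => c _; rewrite !mxE.
Qed.

Lemma tensblock_ctr A i j : tensblock (ctr A) i j = ctr (tensblock A j i).
Proof. by apply/matrixP => a b; rewrite !mxE. Qed.

Lemma tensblock_tens1 J i j : tensblock (J *t 1%:M) i j = (J i j)%:M.
Proof. by apply/matrixP => a b; rewrite mxE tensmxE !mxE mulr_natr. Qed.

Lemma tensblock_sum (V : 'I_q -> 'I_q -> 'M[K]_n) i j :
  tensblock (\sum_i \sum_j (delta_mx i j : 'M[K]_q) *t V i j) i j = V i j.
Proof.
apply/matrixP => a b; rewrite mxE summxE (bigD1 i) //= [X in _ + X]big1 ?addr0; last first.
  move=> k ki; rewrite summxE big1 // => l _.
  by rewrite tensmxE mxE eq_sym (negPf ki) mul0r.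
rewrite summxE (bigD1 j) //= [X in _ + X]big1 ?addr0; last first.
  by move=> l lj; rewrite tensmxE mxE [j == l]eq_sym (negPf lj) andbF mul0r.
by rewrite tensmxE mxE !eqxx mul1r.
Qed.

End Blocks.

Section UnitarySeries.
Variables (K : numClosedFieldType) (N q : nat).

Lemma J_unitary_blocks (J : 'M[K]_q) n (V : 'I_q -> 'I_q -> 'M[K]_n) :
  let M := \sum_i \sum_j (delta_mx i j : 'M[K]_q) *t V i j in
  M *m (J *t 1%:M) *m ctr M = J *t 1%:M ->
  forall i l, \sum_j \sum_k J j k *: (V i j *m ctr (V l k)) = (J i l)%:M.
Proof.
move=> M /(congr1 (fun A => tensblock A _ _)) MJM i l.
rewrite -tensblock_tens1 -MJM tensblockM exchange_big; apply: eq_bigr => k _.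
rewrite tensblock_ctr tensblock_sum tensblockM mulmx_suml; apply: eq_bigr => j _.
by rewrite tensblock_tens1 tensblock_sum mul_mx_scalar scalemxAl.
Qed.

(** Each entry of F J F^# - J is the expansion of an expression [E] that vanishes at every
    skew-Hermitian tuple where it is defined; [expands_eq0] then kills its coefficients. *)
Lemma J_unitary_series (J : 'M[K]_q) (F : fps N 'M[K]_q) :
  rational_mxfps F -> matrix_J_unitary J F ->
  forall w, conv F (fun u => J *m adjfps F u) w = if w is [::] then J else 0.
Proof.
move=> ratF unF w; apply/matrixP => i l.
pose e a b := sval (cid (ratF a b)).
have eF a b : expands (e a b) (fun w => F w a b) by apply: svalP (cid (ratF a b)).
pose t := enum 'I_q.
(* The last summand is zero; it forces all entries of [F] to be defined
   wherever the whole expression is. *)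
pose E := RAdd
  (rsum t (fun j => rsum t (fun k =>
     RMul (RConst N (J j k)) (RMul (e i j) (adjexp (e l k))))))
  (RAdd (RConst N (- J i l))
     (RMul (RConst N 0) (rsum t (fun a => rsum t (fun b => e a b))))).
pose f1 : fps N K := fun w => \sum_(j <- t) \sum_(k <- t)
  fps_mul (fps_const (J j k)) (fps_mul (fun w => F w i j) (adjser (fun w => F w l k))) w.
pose f3 : fps N K := fun w => \sum_(a <- t) \sum_(b <- t) F w a b.
have Ef : expands E
    (fun w => f1 w + (fps_const (- J i l) w + fps_mul (fps_const 0) f3 w)).
  exists f1, (fun w => fps_const (- J i l) w + fps_mul (fps_const 0) f3 w); split=> //.
    apply: (expands_rsum t) => j; apply: (expands_rsum t) => k.
    exists (fps_const (J j k)); eexists; split=> //.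
    by do 2 eexists; split; [exact: eF | exact/expands_adjexp/eF |].
  exists (fps_const (- J i l)), (fps_mul (fps_const 0) f3); split=> //.
  exists (fps_const 0), f3; split=> //.
  by apply: (expands_rsum t) => a; apply: (expands_rsum t) => b.
have /(expands_eq0 Ef)/(_ w) : forall n (Z : 'I_N -> 'M[K]_n) M,
    (forall k, ctr (Z k) = - Z k) -> eval_rexp Z E M -> M = 0.
  move=> n Z M skZ EM.
  case: (EM) => M1 [M2 [_ [M3 [M4 [_ [M5 [M6 [_ E3 _]]] _]]] _]].
  have exV a b : exists V, eval_rexp Z (e a b) V.
    have [] := eval_rsum_inv (i := a) E3; first by rewrite mem_enum.
    by move=> W /(eval_rsum_inv (i := b)); apply; rewrite mem_enum.
  pose V a b := sval (cid (exV a b)).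
  have eV a b : eval_rexp Z (e a b) (V a b) by apply: svalP (cid (exV a b)).
  have unV : forall i l, \sum_j \sum_k J j k *: (V i j *m ctr (V l k)) = (J i l)%:M.
    apply/J_unitary_blocks/(unF n Z); last by exists e, V.
    (* Multiplication by -i turns a skew-Hermitian matrix into a Hermitian one. *)
    move=> k; exists (- 'i *: Z k); last first.
      by rewrite scalerA mulrN -expr2 sqrCi opprK scale1r.
    rewrite /Defs.hermitian linearZ map_mxZ /= skZ rmorphN /= conjCi opprK.
    by rewrite scalerN scaleNr.
  (* Values are unique, so it suffices to derive the value 0, which [unV] supplies. *)
  apply: eval_rexp_uniq EM _.
  exists (\sum_(j <- t) \sum_(k <- t) (J j k)%:M *m (V i j *m ctr (V l k))).
  exists ((- J i l)%:M + 0%:M *m \sum_(a <- t) \sum_(b <- t) V a b); split.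
  - apply: eval_rsum => j; apply: eval_rsum => k.
    exists (J j k)%:M, (V i j *m ctr (V l k)); split=> //.
    by do 2 eexists; split; [exact: eV | exact/eval_adjexp/eV |].
  - exists (- J i l)%:M, (0%:M *m \sum_(a <- t) \sum_(b <- t) V a b); split=> //.
    exists 0%:M, (\sum_(a <- t) \sum_(b <- t) V a b); split=> //.
    by apply: eval_rsum => a; apply: eval_rsum => b.
  rewrite mul_scalar_mx scale0r addr0 raddfN /= -unV; apply/esym/eqP.
  rewrite subr_eq0 /t big_enum; apply/eqP/eq_bigr => j _.
  by rewrite big_enum; apply: eq_bigr => k _; rewrite mul_scalar_mx.
rewrite fps_mul_constl mul0r addr0 => /eqP; rewrite addr_eq0 => /eqP f1E.
transitivity (f1 w); last first.
  by rewrite f1E; case: (w) => [|? ?] /=; rewrite ?opprK ?mxE ?oppr0.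
rewrite summxE /f1 /t big_enum /=.
under eq_bigr do rewrite mxE.
rewrite exchange_big; apply: eq_bigr => j _; rewrite big_enum /=.
under eq_bigr do rewrite mxE mulr_sumr.
rewrite exchange_big; apply: eq_bigr => k _.
rewrite fps_mul_constl mulr_sumr; apply: eq_bigr => s _.
by rewrite mulrCA !mxE.
Qed.

End UnitarySeries.

(** * The observability map *)

Section LinearOf.
Variables (K : fieldType) (U V : lmodType K) (f : U -> V) (lin_f : linear f).
HB.instance Definition _ := GRing.isLinear.Build K U V *:%R f lin_f.
Definition linear_of : {linear U -> V} := f.
End LinearOf.

Section ObservabilityMap.
Variables (K : numClosedFieldType) (N q : nat).
Implicit Types (m : mxnode K N q) (F : fps N 'M[K]_q).

Definition obsmap m k (x : 'cV[K]_(mxdim m k)) : fps N 'cV[K]_q :=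
  fun w => mxCA m w k *m x.

Lemma obsmap_is_linear m k : linear (@obsmap m k).
Proof.
move=> a x y; apply: funext => w.
by rewrite /obsmap mulmxDr -scalemxAr.
Qed.

HB.instance Definition _ m k := GRing.isLinear.Build K _ _ *:%R (@obsmap m k)
  (@obsmap_is_linear m k).

Lemma obsmap_inj m k : observable m -> injective (@obsmap m k).
Proof.
by move=> om x y xy; apply: (observable_inj om) => w; apply: (congr1 (@^~ w) xy).
Qed.

Section Iso.
Variables (J : 'M[K]_q) (F : fps N 'M[K]_q) (m : mxnode K N q).
Variable H : forall k, 'M[K]_(mxdim m k).
Hypotheses (om : observable m) (uH : forall k, H k \in unitmx).
Hypothesis kerF : dBR_kernel J F = mxkernel H.

Lemma dBR_kernel_obsmap k w' (c : 'cV[K]_q) :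
  (fun w => dBR_kernel J F k w w' *m c) =
  obsmap (invmx (H k) *m ctr (mxCA m w' k) *m c).
Proof. by apply: funext => w; rewrite kerF /mxkernel /obsmap !mulmxA. Qed.

(** By [dBR_kernel_obsmap] the spanning series are images of the vectors H_k^{-1} ((C flat A)^{w'
    g_k})^* c. By observability and invertibility of H_k, these span the state space. *)
Lemma obsmap_in_dBR k x :
  @obsmap m k x \in span_pred [set f : fps N 'cV[K]_q | exists w' c,
           f = fun w => dBR_kernel J F k w w' *m c]%classic.
Proof.
have [s us] := observable_basis k om.
set O := (\matrix_i _) in us.
have uO : ctr O \in unitmx by rewrite map_unitmx unitmx_tr.
(* The coordinates solving x = H_k^{-1} O^* z. *)
pose z := invmx (ctr O) *m H k *m x.
pose v i : 'cV[K]_(mxdim m k) :=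
  invmx (H k) *m ctr (mxCA m (s i).1 k) *m delta_mx (s i).2 ord0.
apply/asboolP; exists (mxdim m k), (fun i => z i ord0), (fun i => obsmap (v i)).
split=> [i|]; first by exists (s i).1, (delta_mx (s i).2 ord0); rewrite dBR_kernel_obsmap.
have -> : x = \sum_i z i ord0 *: v i.
  have {1}-> : x = invmx (H k) *m (ctr O *m z).
    by rewrite /z !mulmxA mulmxK // mulVmx // mul1mx.
  rewrite mulmxA; apply/colP => a; rewrite mxE summxE; apply: eq_bigr => i _.
  rewrite [RHS]mxE mulrC /v -mulmxA -colE -col_mul; congr (_ * _); rewrite !mxE.
  by apply: eq_bigr => b _; rewrite !mxE.
by rewrite linear_sum; apply: eq_bigr => i _; rewrite linearZ.
Qed.

Lemma dBR_obsmap k (f : dBR J F k) : exists x, dBR_fps f = @obsmap m k x.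
Proof.
case: f => f /=; rewrite /dBR_fps /= => /asboolP[n [a [u [Su ->]]]].
have /choice[x xE] i : exists x, u i = @obsmap m k x.
  have [w' [c ->]] := Su i.
  by rewrite dBR_kernel_obsmap; eexists.
exists (\sum_i a i *: x i); rewrite linear_sum; apply: eq_bigr => i _.
by rewrite linearZ xE.
Qed.

Lemma dBR_iso : exists (Phi : forall k, {linear 'cV[K]_(mxdim m k) -> dBR J F k})
    (Psi : forall k, {linear dBR J F k -> 'cV[K]_(mxdim m k)}),
  [/\ forall k, cancel (Phi k) (Psi k), forall k, cancel (Psi k) (Phi k)
    & forall k x, dBR_fps (Phi k x) = obsmap x].
Proof.
pose phi k x : dBR J F k := Lspan (@obsmap_in_dBR k x).
(* The preimage is chosen, but unique by observability, so [psi] inherits linearity from [phi]. *)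
pose psi k f := sval (cid (@dBR_obsmap k f)).
have phiK k : cancel (phi k) (psi k).
  move=> x; apply: (obsmap_inj om).
  by rewrite -(svalP (cid (dBR_obsmap (phi k x)))).
have psiK k : cancel (psi k) (phi k).
  by move=> f; apply: val_inj; rewrite /= -(svalP (cid (dBR_obsmap f))).
have lin_phi k : linear (phi k).
  move=> a x y; apply: val_inj.
  by rewrite /= linearP.
have lin_psi k : linear (psi k).
  by move=> a f g; apply: (can_inj (phiK k)); rewrite lin_phi !psiK.
by exists (fun k => linear_of (lin_phi k)), (fun k => linear_of (lin_psi k)).
Qed.

End Iso.
End ObservabilityMap.

(** * Transport to the backward-shift node *)

Lemma dBR_kernel_realization (K : numClosedFieldType) N q (J : 'M[K]_q)
    (F : fps N 'M[K]_q) :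
  signature_mx J -> rational_mxfps F -> matrix_J_unitary J F ->
  exists m (H : forall k, 'M[K]_(mxdim m k)),
    [/\ minimal_GR_realization (node_of_mx m) F, associated_hermitian J H
      & dBR_kernel J F = mxkernel H].
Proof.
move=> sJ ratF unF.
(* Once the set is shown to be non-empty, [xget] returns one of its elements and not the default
   0. *)
apply: (@xgetPex _ (fun _ _ _ => 0) [set Ker | exists m (H : forall k, 'M[K]_(mxdim m k)),
  [/\ minimal_GR_realization (node_of_mx m) F, associated_hermitian J H
    & Ker = mxkernel H]]%classic).
have [m0 m0F] := recognizable_realization (rational_mx_recognizable ratF).
have [m [mm0 rm om]] := reachable_observable_exists m0.
have mF w : mxtransfer m w = F w by rewrite mm0.
have FJF w : conv (mxtransfer m) (fun u => J *m adjfps (mxtransfer m) u) w =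
    if w is [::] then J else 0.
  rewrite -(J_unitary_series ratF unF); apply: eq_conv => // u.
  by rewrite /adjfps mF.
have [H aH] := associated_hermitian_exists sJ rm om FJF.
exists (mxkernel H), m, H; split=> //.
exact: reachable_observable_minimal.
Qed.

Theorem theorem8p2 (R : realType) (N q : nat) (J : 'M[R[i]]_q)
    (F : fps N 'M[R[i]]_q)
    (HJ : signature_mx J) (Frat : rational_mxfps F)
    (Funitary : matrix_J_unitary J F) :
  exists (d : 'I_N -> nat) (coords : forall k, Vector.axiom (d k) (dBR J F k))
    (A : forall k j, {linear dBR J F j -> dBR J F k})
    (B : forall k, {linear 'cV[R[i]]_q -> dBR J F k})
    (C : forall k, {linear dBR J F k -> 'cV[R[i]]_q})
    (D : {linear 'cV[R[i]]_q -> 'cV[R[i]]_q}),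
    [/\ forall k j (f : dBR J F j), dBR_fps (A k j f) = bshift k (dBR_fps f),
        forall k c, dBR_fps (B k c) = bshift k (fun w => F w *m c),
        forall k (f : dBR J F k), C k f = dBR_fps f [::],
        forall c, D c = F [::] *m c
      & minimal_GR_realization
          (@GRNode R[i] N q (fun k => findim (coords k)) A B C D) F].
Proof.
have [m [H [minm [uH _ _] kerF]]] := dBR_kernel_realization HJ Frat Funitary.
have [/mx_GR_realization mF dimm] := minm.
have om := minimal_observable minm.
have [Phi [Psi [PhiK PsiK PhiE]]] := dBR_iso om (fun k => (uH k).2) kerF.
(* [Vector.axiom] asks for row coordinates, hence the transposes. *)
have coordsP k : bijective (fun f => (Psi k f)^T).
  exists (fun x => Phi k x^T) => [f|x]; first by rewrite trmxK PsiK.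
  by rewrite PhiK trmxK.
have lin_coords k : linear (fun f => (Psi k f)^T).
  by move=> a f g; rewrite linearP linearP.
pose coords k : Vector.axiom (mxdim m k) (dBR J F k) :=
  @exist2 _ _ _ _ (lin_coords k) (coordsP k).
exists (mxdim m), coords.
pose A k j : {linear dBR J F j -> dBR J F k} := Phi k \o mulmx (mxA m k j) \o Psi j.
pose B k : {linear 'cV[R[i]]_q -> dBR J F k} := Phi k \o mulmx (mxB m k).
pose C k : {linear dBR J F k -> 'cV[R[i]]_q} := mulmx (mxC m k) \o Psi k.
exists A, B, C, (mulmx (F [::])); split=> //.
(* (C flat A)^{w g_k} A_{kj} = (C flat A)^{w g_k g_j}, so [obsmap] turns the block of A into the
   shift R_k. *)
- move=> k j f; rewrite PhiE -{2}[f]PsiK PhiE; apply: funext => w.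
  by rewrite /obsmap /bshift mxCA_rcons !mulmxA.
(* The case of [mxCA_AB] with nothing after the letter k: (C flat A)^{w g_k} B_k = F_{w g_k}. *)
- move=> k c; rewrite PhiE; apply: funext => w.
  by rewrite /obsmap /bshift mulmxA (mxCA_AB m w k [::]) mF cats1.
- by move=> k f; rewrite -{2}[f]PsiK PhiE.
set a := GRNode _ _ _ _.
have AB w k c : @node_AB _ _ _ a k w c = Phi k (mxAB m k w *m c).
  by elim: w k => [|j w IHw] k //=; rewrite IHw /= PhiK !mulmxA.
split=> [[|j w] c|b bF k] //=.
  by rewrite AB /= PhiK mulmxA -mF.
(* The coordinates give K_k(F) the dimension [mxdim m k], so minimality is inherited from [m]. *)
have := dimm _ bF k; rewrite dim_colvec; apply: leq_trans.
by rewrite dimvf.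
Qed.
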